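(* Let $(W,S)$ be a Coxeter system with $W$ a finite group generated by reflections of a real vector space $V$, and let $w_0$ be its longest element. Fix $T>0$. The transformation $I=\mathcal P_{w_0}(-w_0)\kappa$ of continuous paths $\pi:[0,T]\to V$ with $\pi(0)=0$ has the following properties: (i) $I^2=\mathcal P_{w_0}$; (ii) the restriction of $I$ to dominant paths is an involution; (iii) $I\mathcal P_{w_0}=I$; (iv) for all paths $\pi$, one has $I\pi(T)=\mathcal P_{w_0}\pi(T)$; in particular $I\pi(T)=\pi(T)$ when $\pi$ is dominant.
   Context: For each $s\in S$ there are given $\alpha_s\in V$ and $\alpha_s^\vee\in V^\vee$ (dual space) with $\alpha_s^\vee(\alpha_s)=2$ and $s(v)=v-\alpha_s^\vee(v)\alpha_s$ (simple roots and coroots); for $s\ne t$ in $S$, $\alpha_s^\vee(\alpha_t)\le0$, $\alpha_s^\vee(\alpha_t)=0$ if and only if $\alpha_t^\vee(\alpha_s)=0$, and $\alpha_s^\vee(\alpha_t)\alpha_t^\vee(\alpha_s)=4\cos^2(\pi/m(s,t))$, where $m(s,t)$ is the order of $st$. Paths are continuous maps $\pi:[0,T]\to V$ with $\pi(0)=0$. $\mathcal P_s\pi(t)=\pi(t)-\inf_{0\le u\le t}\alpha_s^\vee(\pi(u))\alpha_s$; these satisfy the braid relations, so $\mathcal P_w=\mathcal P_{s_1}\cdots\mathcal P_{s_l}$ is well defined for any reduced decomposition $w=s_1\cdots s_l$. The map $\kappa$ is $\kappa\pi(t)=\pi(T-t)-\pi(T)$; $-w_0$ acts pointwise on paths, $(-w_0)\pi(t)=-w_0(\pi(t))$.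 A path $\pi$ is dominant if $\alpha_s^\vee(\pi(t))\ge0$ for all $s\in S$ and $t\in[0,T]$. *)

(* Defs.v *)
From HB Require Import structures.
From mathcomp Require Import all_boot all_order all_fingroup all_algebra.
From mathcomp Require Import all_classical all_reals topology normedtype.
From mathcomp Require Import sequences trigo.

Set Implicit Arguments.
Unset Strict Implicit.
Unset Printing Implicit Defensive.

Import Order.TTheory GRing.Theory Num.Theory.
Import numFieldTopology.Exports numFieldNormedType.Exports.

Local Open Scope classical_set_scope.
Local Open Scope ring_scope.

Section Coxeter.
Variables (W : finGroupType) (S : {set W}).
Local Open Scope group_scope.

(* The last clause is the universal property of the presentation
   W = < S | (s t)^m(s,t) = 1 >, where m(s,t) = #[s * t]; it ranges over all,
   possibly infinite, groups. *)
Definition coxeter_system : Prop :=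
  [/\ {in S, forall s, #[s] = 2%N},
      <<S>> = [set: W]%SET &
      forall (G : groupType) (f : W -> G),
        {in S &, forall s t, (f s * f t) ^+ #[s * t] = 1} ->
        exists phi : {multiplicative W -> G}, {in S, phi =1 f}].

Definition word_of (w : W) (r : seq W) : Prop :=
  {subset r <= S} /\ \prod_(s <- r) s = w.

Definition reduced_word (w : W) (r : seq W) : Prop :=
  word_of w r /\ (forall r' : seq W, word_of w r' -> (size r <= size r')%N).

Definition longest_element (w0 : W) : Prop :=
  forall (w : W) (r r0 : seq W),
    reduced_word w r -> reduced_word w0 r0 -> (size r <= size r0)%N.

End Coxeter.

Section ReflectionGroup.
Variables (R : realType) (V : topologicalLmodType R).
Variables (W : finGroupType) (S : {set W}).

Definition linear_group (rho : W -> {linear V -> V}) : Prop :=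
  [/\ forall v, rho 1%g v = v,
      forall (x y : W) v, rho (x * y)%g v = rho x (rho y v) &
      forall x y : W, rho x =1 rho y -> x = y].

(* The dual of V is its topological dual; the continuity clause is automatic
   when V is finite-dimensional with its usual topology. *)
Definition simple_roots (rho : W -> {linear V -> V})
    (alpha : W -> V) (coalpha : W -> {scalar V}) : Prop :=
  [/\ {in S, forall s, continuous (coalpha s : V -> R)},
      {in S, forall s, coalpha s (alpha s) = 2},
      {in S, forall s v, rho s v = v - coalpha s v *: alpha s} &
      {in S &, forall s t, s != t ->
        [/\ coalpha s (alpha t) <= 0,
            coalpha s (alpha t) = 0 <-> coalpha t (alpha s) = 0 &
            coalpha s (alpha t) * coalpha t (alpha s) =
              4 * cos (pi / #[s * t]%g%:R) ^+ 2]}].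

End ReflectionGroup.

(* A path [0, T] -> V is represented by a total function R -> V; its values
   outside [0, T] are irrelevant. *)
Section Paths.
Variables (R : realType) (V : topologicalLmodType R) (T : R).

Definition is_path (p : R -> V) : Prop :=
  {within `[0, T], continuous p} /\ p 0 = 0.

Definition path_eq (p q : R -> V) : Prop :=
  forall t : R, 0 <= t <= T -> p t = q t.

Definition pitman (a : V) (a' : {scalar V}) (p : R -> V) : R -> V :=
  fun t => p t - inf [set a' (p u) | u in `[0, t]] *: a.

Definition kappa (p : R -> V) : R -> V := fun t => p (T - t) - p T.

Variables (W : finGroupType) (S : {set W}) (rho : W -> {linear V -> V}).
Variables (alpha : W -> V) (coalpha : W -> {scalar V}).

Definition dominant (p : R -> V) : Prop :=
  is_path p /\
  {in S, forall s (t : R), 0 <= t <= T -> 0 <= coalpha s (p t)}.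

(* pitman_word [:: s1; ...; sl] = P_{s1} o ... o P_{sl} *)
Definition pitman_word (r : seq W) (p : R -> V) : R -> V :=
  foldr (fun s => pitman (alpha s) (coalpha s)) p r.

Definition neg_act (w : W) (p : R -> V) : R -> V := fun t => - rho w (p t).

(* r is meant to be a reduced decomposition of w0 *)
Definition involution_I (w0 : W) (r : seq W) (p : R -> V) : R -> V :=
  pitman_word r (neg_act w0 (kappa p)).

End Paths.

(* Main.v *)
Require Import Defs.
From HB Require Import structures.
From mathcomp Require Import all_boot all_order all_fingroup all_solvable.
From mathcomp Require Import all_algebra all_classical all_reals.
From mathcomp Require Import topology normedtype derive trigo.
From mathcomp Require Import lra ring zify.

(** Everything rests on Pitman's identity
      inf_[q,p] (Z - 2 I) = inf_[q,p] Z - I q - I p,   I u = inf_[0,u] Z.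
    It yields P_s kappa P_s = P_s kappa. Since -w0 permutes the simple roots up
    to positive factors, (-w0) P_s = P_s* (-w0), and P_w0 can be written so as
    to end with P_s*; hence I P_s = I, which is (iii). As ((-w0) kappa)^2 = id,
    (iii) gives I^2 = P_w0, and (ii) follows because P_w0 takes dominant values
    and fixes dominant paths. For (iv) one may assume p dominant. For a
    W-invariant form, a Pitman transform never decreases the squared length of
    the end point and preserves it only if the end point moves inside its
    orbit; since I (I p) = p, the end point of I p is a dominant element of the
    orbit of p T, that is, p T itself.

    That P_w does not depend on the reduced word is Matsumoto's theorem plus
    the braid relations, and the latter come from an explicit formula for
    P_s P_t P_s ... with Chebyshev coefficients, which becomes symmetric in s
    and t when the number of factors is the order of s t. The facts needed on
    the reflection representation are read off P_w0 acting on straight lines: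
    it is constant on orbits and sends w0^-1 v to v for v dominant, whence all
    the steps of a reduced word of w0 are genuine reflections. *)

Set Implicit Arguments.
Unset Strict Implicit.
Unset Printing Implicit Defensive.

(** * Exchange condition and Matsumoto's theorem *)

Section CoxeterWords.
Local Open Scope group_scope.
Variables (W : finGroupType) (S : {set W}).
Hypothesis hWS : coxeter_system S.
Implicit Types (s t a x w : W) (r q z : seq W).

Local Notation prodw r := (\prod_(s <- r) s).

Lemma mulss s : s \in S -> s * s = 1.
Proof. by case: hWS => h _ _ /h o; rewrite -expg2 -o expg_order. Qed.

Lemma invs s : s \in S -> s^-1 = s.
Proof. by move=> sS; apply: (mulgI s); rewrite mulgV mulss. Qed.

Definition words r := {subset r <= S}.

Lemma words_cons s r : words (s :: r) <-> s \in S /\ words r.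
Proof.
split=> [h|[sS h] x]; last by rewrite inE => /orP[/eqP->//|/h].
by split=> [|x xr]; apply: h; rewrite inE ?eqxx// xr orbT.
Qed.

Lemma words_cat r q : words (r ++ q) <-> words r /\ words q.
Proof.
split=> [h|[h1 h2] x]; last by rewrite mem_cat => /orP[/h1|/h2].
by split=> x xr; apply: h; rewrite mem_cat xr ?orbT.
Qed.

Lemma words_rev r : words r -> words (rev r).
Proof. by move=> h x; rewrite mem_rev => /h. Qed.

Lemma prodw_rev r : words r -> prodw (rev r) = (prodw r)^-1.
Proof.
elim: r => [|s r IH]; first by rewrite big_nil invg1.
move=> /words_cons[sS rS]; rewrite rev_cons -cats1 big_cat /= big_seq1 big_cons
  IH// invMg.
by rewrite (invs sS).
Qed.

Lemma words_exist w : exists r, word_of S w r.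
Proof.
have : w \in <<S>> by case: hWS => _ -> _; rewrite inE.
case/gen_prodgP=> n [c cS ->].
exists [seq c i | i <- index_enum 'I_n]; split.
  by move=> x /mapP[i _ ->].
by rewrite big_map.
Qed.

Lemma reduced_exists w : exists r, reduced_word S w r.
Proof.
have [r0 h0] := words_exist w.
have ex : exists n, `[< exists2 r, word_of S w r & size r = n >].
  by exists (size r0); apply/asboolP; exists r0.
case: (ex_minnP ex) => n /asboolP[r hr <-] hmin.
by exists r; split=> // r' hr'; apply: hmin; apply/asboolP; exists r'.
Qed.

Lemma reduced_words w r : reduced_word S w r -> words r.
Proof. by case=> -[]. Qed.

Lemma reduced_prod w r : reduced_word S w r -> prodw r = w.
Proof. by case=> -[]. Qed.

Lemma reduced_le w r r' : reduced_word S w r -> word_of S w r' ->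
  (size r <= size r')%N.
Proof. by case=> _ h /h. Qed.

Lemma reduced_size w r r' : reduced_word S w r -> reduced_word S w r' ->
  size r = size r'.
Proof. by move=> [h1 h2] [h3 h4]; apply/eqP; rewrite eqn_leq h2 ?h4. Qed.

Lemma reduced_of_size w r r' : reduced_word S w r -> word_of S w r' ->
  (size r' <= size r)%N -> reduced_word S w r'.
Proof. by move=> [h1 h2] h3 le; split=> // q /h2; apply: leq_trans. Qed.

Lemma reduced_rev w r : reduced_word S w r -> reduced_word S w^-1 (rev r).
Proof.
move=> [[rS <-] h]; split; first by split; [exact: words_rev|exact: prodw_rev].
move=> r' [r'S e]; rewrite size_rev -(size_rev r'); apply: h.
by split; [exact: words_rev|rewrite prodw_rev// e invgK].
Qed.

Lemma reduced_cons w s r : reduced_word S w (s :: r) ->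
  s \in S /\ reduced_word S (s * w) r.
Proof.
move=> [[/words_cons[sS rS] <-] h]; split=> //;
  rewrite big_cons mulgA mulss// mul1g.
split=> // r' [r'S e]; rewrite -ltnS; apply: (h (s :: r')).
by split; [exact/words_cons|rewrite !big_cons e].
Qed.

(* [eta r x] is the parity of the number of times the reflection [x] occurs
   among the reflections a_1 ... a_(j-1) a_j a_(j-1) ... a_1 of the word [r]. *)
Fixpoint eta r x : bool :=
  if r is s :: r' then (x == s) (+) eta r' (x ^ s) else false.

Fixpoint alt n s t : seq W := if n is n'.+1 then s :: alt n' t s else [::].

Lemma size_alt n s t : size (alt n s t) = n.
Proof. by elim: n s t => //= n IH s t; rewrite IH. Qed.

Lemma alt_rcons n s t : alt n.+1 s t = rcons (alt n s t) (if odd n then t else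
  s).
Proof.
elim: n s t => // n IH s t; rewrite [LHS]/= -/(alt n.+1 t s) IH /=.
by case: (odd n).
Qed.

Lemma words_alt n s t : s \in S -> t \in S -> words (alt n s t).
Proof.
elim: n s t => [|n IH] s t sS tS //; by apply/words_cons; split; last exact: IH.
Qed.


Lemma alt_prodE s t j : s * (t * s) ^+ j * t = (s * t) ^+ j.+1.
Proof.
elim: j => [|j IH]; first by rewrite mulg1.
by rewrite expgSr !mulgA IH -mulgA -expgSr.
Qed.

Lemma eta_alt n s t x : s \in S -> t \in S ->
  eta (alt n s t) x = \big[addb/false]_(j < n) (x == (s * t) ^+ j * s).
Proof.
elim: n s t x => [|n IH] s t x sS tS; first by rewrite big_ord0.
rewrite big_ord_recl /= IH// mul1g; congr (_ (+) _).
apply: eq_bigr => j _; rewrite -(inj_eq (conjg_inj s) (x ^ s)) -conjgM mulss//.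
rewrite conjg1 /conjg invs//; congr (_ == _).
by rewrite /bump /= add1n -alt_prodE !mulgA.
Qed.

Lemma addb_big_double n (F : nat -> bool) : (forall j, F (n + j)%N = F j) ->
  \big[addb/false]_(j < n + n) F j = false.
Proof.
move=> h; rewrite big_split_ord /=.
by under [X in _ (+) X]eq_bigr do rewrite h; rewrite addbb.
Qed.

(** The classical action of a generator on signed reflections, extended to all of [W] so that the
    set of reflections need not be singled out. *)
Definition refl_fun s (p : W * bool) : W * bool := (p.1 ^ s, p.2 (+) (p.1 ==
  s)).

Lemma refl_fun_inj s : injective (refl_fun s).
Proof.
move=> [x b] [y c] [] /= /conjg_inj -> /eqP.
by rewrite (inj_eq (@addIb _)) => /eqP->.
Qed.

Definition refl_perm s : {perm W * bool} := perm (@refl_fun_inj s).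

Lemma refl_perm_prod r x b :
  (\prod_(s <- r) refl_perm s) (x, b) = (x ^ prodw r, b (+) eta r x).
Proof.
elim: r x b => [|s r IH] x b; first by rewrite !big_nil perm1 conjg1 addbF.
by rewrite !big_cons permM permE /refl_fun /= IH conjgM addbA.
Qed.

Lemma prod_alt (G : groupType) (f : W -> G) n s t :
  \prod_(a <- alt (n + n) s t) f a = (f s * f t) ^+ n.
Proof.
elim: n => [|n IH]; first by rewrite big_nil.
by rewrite addSn addnS /= !big_cons IH expgS mulgA.
Qed.

(** The [2m] reflections [(s t)^j s] of the word of [(s t)^m] have period [m] in [j], so each occurs
    an even number of times. *)
Lemma refl_perm_braid : {in S &, forall s t,
  (refl_perm s * refl_perm t) ^+ #[s * t] = 1}.
Proof.
move=> s t sS tS; apply/permP => -[x b]; rewrite -prod_alt refl_perm_prod perm1.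
rewrite (@prod_alt W id) expg_order conjg1 eta_alt//.
rewrite (@addb_big_double _ (fun j => x == (s * t) ^+ j * s)) ?addbF// => j.
by rewrite expgD expg_order mul1g.
Qed.

(** By the presentation of [W], the [refl_perm s] extend to a homomorphism, whose sign at
    [(x, false)] is the parity [eta r x]. *)
Lemma eta_word r q x : words r -> words q -> prodw r = prodw q -> eta r x = eta
  q x.
Proof.
move=> rS qS e.
have [phi hphi] : exists phi : {multiplicative W -> {perm W * bool}},
    {in S, phi =1 refl_perm}.
  by case: hWS => _ _; apply; exact: refl_perm_braid.
have phiE z : words z -> \prod_(s <- z) refl_perm s = phi (prodw z).
  elim: z => [|s z IH].
    by move=> _; rewrite !big_nil; apply: (mulgI (phi 1));
      rewrite mulg1 -gmulfM mulg1.
  by move=> /words_cons[sS zS]; rewrite !big_cons gmulfM IH// (hphi s sS).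
have := congr1 (fun p : {perm W * bool} => (p (x, false)).2) (phiE r rS).
by rewrite e -phiE// !refl_perm_prod /= => ->.
Qed.

Lemma eta_split r x : eta r x ->
  exists r1 a r2, r = r1 ++ a :: r2 /\ x * prodw r1 = prodw r1 * a.
Proof.
elim: r x => //= s r IH x.
have [->|_] /= := eqVneq x s.
  by exists [::], s, r; rewrite big_nil mulg1 mul1g.
move=> /IH[r1 [a [r2 [-> e]]]]; exists (s :: r1), a, r2; split=> //.
by rewrite big_cons -mulgA -e /conjg !mulgA mulgV mul1g.
Qed.

(** If [eta r s] is odd, [s] is a reflection of [r] and a letter can be deleted. If it is even, [s]
    is odd in [s :: r], hence in any reduced word [q] of [s * w], and a deletion in [q] shows that
    [q] is longer than [r]. *)
Lemma exchange w s r : s \in S -> reduced_word S w r ->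
  reduced_word S (s * w) (s :: r) \/
  exists r1 a r2, [/\ r = r1 ++ a :: r2, s * prodw r1 = prodw r1 * a
    & reduced_word S (s * w) (r1 ++ r2)].
Proof.
move=> sS hr; have rS := reduced_words hr.
have [q hq] := reduced_exists (s * w); have qS := reduced_words hq.
have del z r1 a r2 : z = r1 ++ a :: r2 -> words z ->
    s * prodw r1 = prodw r1 * a -> word_of S (s * prodw z) (r1 ++ r2).
  move=> -> /words_cat[h1 /words_cons[aS h2]] e; split; first exact/words_cat.
  by rewrite !big_cat big_cons /= !mulgA e -(mulgA _ a a) mulss// mulg1.
have lenq : (size r <= (size q).+1)%N.
  apply: (reduced_le hr (r' := s :: q)); split; first exact/words_cons.
  by rewrite big_cons (reduced_prod hq) mulgA mulss// mul1g.
have [/eta_split[r1 [a [r2 [er e]]]]|etar] := boolP (eta r s).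
  right; exists r1, a, r2; split=> //.
  have h := del _ _ _ _ er rS e; rewrite (reduced_prod hr) in h.
  apply: (reduced_of_size hq h); move: lenq.
  by rewrite er !size_cat /= addnS ltnS.
left; have /eta_split[r1 [a [r2 [er e]]]] : eta q s.
  rewrite (@eta_word q (s :: r)) /= ?eqxx//.
- by rewrite conjgE mulKg (negbTE etar).
- exact/words_cons.
- by rewrite big_cons (reduced_prod hr) (reduced_prod hq).
have h := del _ _ _ _ er qS e; rewrite (reduced_prod hq) mulgA mulss// mul1g in
  h.
apply: (reduced_of_size hq).
  by split; [exact/words_cons|rewrite big_cons (reduced_prod hr)].
have := reduced_le hr h.
by rewrite er !size_cat /= addnS ltnS.
Qed.

Lemma coxeter_order_gt1 s t : s \in S -> t \in S -> s != t -> (1 < #[s * t])%N.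
Proof.
move=> sS tS; apply: contraNltn; rewrite leq_eqVlt ltnS leqn0.
rewrite (gtn_eqF (order_gt0 _)) orbF order_eq1 => /eqP e.
by apply/eqP/(mulIg t); rewrite e mulss.
Qed.


Lemma alt_refl k s t r1 a r2 : s \in S -> t \in S -> alt k s t = r1 ++ a :: r2
  ->
  prodw r1 * a = (s * t) ^+ size r1 * s * prodw r1.
Proof.
elim: r1 k s t => [|b r1 IH] [|k] s t sS tS //=.
  by case=> <- _; rewrite big_nil mulg1 !mul1g.
case=> <- /(IH _ _ _ tS sS) e; rewrite !big_cons -(mulgA s) e.
by rewrite !mulgA alt_prodE -(mulgA _ s s) mulss// mulg1.
Qed.

(** Otherwise [(t s)^(j+1) = 1] for [j = size r1], although [j + 1 <= k] is less than the order. *)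
Lemma alt_refl_neq k s t r1 a r2 : s \in S -> t \in S -> (k < #[s * t])%N ->
  alt k t s = r1 ++ a :: r2 -> s * prodw r1 <> prodw r1 * a.
Proof.
move=> sS tS km ek; rewrite (alt_refl tS sS ek) => /mulIg e.
have : (t * s) ^+ (size r1).+1 = 1 by rewrite expgSr mulgA -e mulss.
move/eqP; rewrite -order_dvdn -orderV invMg (invs sS) (invs tS) =>
  /(dvdn_leq (ltn0Sn _)).
rewrite leqNgt (leq_ltn_trans _ km)//.
by have := congr1 size ek; rewrite size_alt size_cat /= addnS => ->;
  rewrite ltnS leq_addr.
Qed.

Lemma prod_alt_swap n s t : s \in S -> t \in S ->
  prodw (alt n t s) = (t * s) ^+ n * prodw (alt n s t).
Proof.
elim: n s t => [|n IH] s t sS tS; first by rewrite big_nil mulg1.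
have e : t * (s * t) ^+ n = (t * s) ^+ n * t.
  case: n {IH} => [|n]; first by rewrite mul1g mulg1.
  by rewrite expgSr mulgA mulgA alt_prodE.
by rewrite !big_cons IH// mulgA e expgSr -!mulgA (mulgA s) mulss// mul1g.
Qed.

(** Induction on [k] with [s] and [t] swapped. In a word starting with [alt k t s], exchange with
    the left descent [s] deletes a letter, which by [alt_refl_neq] lies beyond the alternating
    prefix. *)
Lemma alt_prefix k w s t r q : (k <= #[s * t])%N -> s != t ->
  reduced_word S w (s :: r) -> reduced_word S w (t :: q) ->
  exists z, reduced_word S w (alt k s t ++ z).
Proof.
elim: k s t r q => [|k IH] s t r q km st hs ht; first by exists (s :: r).
have [sS hs'] := reduced_cons hs; have [tS _] := reduced_cons ht.
have [||z hz] := IH t s q r _ _ ht hs; last 1 first.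
- have [hz'|[r1 [a [r2 [er e hz']]]]] := exchange sS hz.
    have := reduced_size hz' hs' => ez.
    have := reduced_size hz hs => ez2.
    by move: ez; rewrite /= ez2 /= => /eqP; rewrite eqn_leq ltnNge leqnSn.
  have ksz : (size (alt k t s) <= size r1)%N.
    rewrite leqNgt; apply/negP => lt.
    have := congr1 (take (size (alt k t s))) er.
    rewrite take_size_cat// take_cat ltnNge (ltnW lt) /= -(subnSK lt) /= => e1.
    exact: (alt_refl_neq sS tS _ e1 e).
  have er1 : r1 = alt k t s ++ drop (size (alt k t s)) r1.
    have := congr1 (take (size (alt k t s))) er.
    rewrite take_size_cat// takel_cat// => eu.
    by rewrite -[LHS](cat_take_drop (size (alt k t s)) r1) -eu.
  exists (drop (size (alt k t s)) r1 ++ r2); rewrite /= catA -er1.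
  have -> : w = s * (s * w) by rewrite mulgA mulss// mul1g.
  have wE : word_of S w (s :: r1 ++ r2).
    split; first by apply/words_cons; split=> //; exact: reduced_words hz'.
    by rewrite big_cons (reduced_prod hz') mulgA mulss// mul1g.
  rewrite mulgA mulss// mul1g; apply: (reduced_of_size hz wE).
  by rewrite er /= !size_cat /= addnS.
- by rewrite -orderV invMg (invs sS) (invs tS) ltnW.
- by rewrite eq_sym.
Qed.

Section Matsumoto.
Variable E : seq W -> seq W -> Prop.
Hypothesis E_refl : forall r, E r r.
Hypothesis E_sym : forall r q, E r q -> E q r.
Hypothesis E_trans : forall r q z, E r q -> E q z -> E r z.
Hypothesis E_cons : forall s r q, s \in S -> E r q -> E (s :: r) (s :: q).
Hypothesis E_braid : forall s t z, s \in S -> t \in S -> s != t -> words z ->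
  E (alt #[s * t] s t ++ z) (alt #[s * t] t s ++ z).

(** Induction on the length. Words with distinct first letters [s] and [t] are linked through words
    starting with [alt m s t] and [alt m t s], which differ by a braid move; each of these shares
    its first letter with a given word. *)
Theorem matsumoto w r q : reduced_word S w r -> reduced_word S w q -> E r q.
Proof.
have [n] := ubnP (size r); elim: n w r q => // n IH w [|s r] q.
  by move=> _ h1 h2; have := reduced_size h1 h2; case: q {h2}.
case: q => [|t q]; first by move=> _ h1 h2; have := reduced_size h1 h2.
rewrite ltnS => rn hs ht.
have [sS hr] := reduced_cons hs; have [tS hq] := reduced_cons ht.
have [est|st] := eqVneq s t.
  by rewrite -est; rewrite -est in hq; apply: E_cons => //; apply: IH hr hq.
have ots : #[t * s] = #[s * t] by rewrite -orderV invMg !invs.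
have [z hz] := alt_prefix (leqnn _) st hs ht.
have hz' : reduced_word S w (alt #[s * t] t s ++ z).
  have zS : words z by have /reduced_words/words_cat[] := hz.
  apply: (reduced_of_size hz); last by rewrite !size_cat !size_alt.
  split; first by apply/words_cat; split=> //; exact: words_alt.
  rewrite -(reduced_prod hz) !big_cat /=; congr (_ * _).
  by rewrite prod_alt_swap// -ots expg_order mul1g.
apply: (E_trans (q := alt #[s * t] s t ++ z)).
  case: #[s * t] (order_gt0 (s * t)) hz => //= m _ /reduced_cons[_ h].
  by apply: E_cons => //; apply: IH hr h.
apply: (E_trans (q := alt #[s * t] t s ++ z)); last first.
  move: hz'; case: #[s * t] (order_gt0 (s * t)) => //= m _ /reduced_cons[_ h].
  apply: E_cons => //; apply/E_sym; apply: IH hq h.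
  by have [<-] := reduced_size hs ht.
apply: E_braid => //.
by have /reduced_words/words_cat[] := hz.
Qed.
End Matsumoto.

Lemma left_descent w s r : s \in S -> reduced_word S w r ->
  reduced_word S (s * w) (s :: r) \/ exists q, reduced_word S w (s :: q).
Proof.
move=> sS hr; have [h|[r1 [a [r2 [er e h]]]]] := exchange sS hr; first by left.
right; exists (r1 ++ r2); apply: (reduced_of_size hr); last first.
  by rewrite er /= !size_cat /= addnS.
split; first by apply/words_cons; split=> //; exact: reduced_words h.
by rewrite big_cons (reduced_prod h) mulgA mulss// mul1g.
Qed.

Section Longest.
Variables (w0 : W) (hw0 : longest_element S w0).

Lemma longest_size w q r : reduced_word S w q -> reduced_word S w0 r ->
  (size q <= size r)%N.
Proof. exact: hw0. Qed.

Lemma longest_inv : longest_element S w0^-1.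
Proof.
move=> w r r0 hr /reduced_rev; rewrite invgK => h0.
by rewrite -(size_rev r0); apply: hw0 hr h0.
Qed.

Lemma longest_left s : s \in S -> exists q, reduced_word S w0 (s :: q).
Proof.
move=> sS; have [r hr] := reduced_exists w0.
have [h|//] := left_descent sS hr.
by have := longest_size h hr; rewrite ltnn.
Qed.
End Longest.

Lemma longest_right w0 s : longest_element S w0 -> s \in S ->
  exists q, reduced_word S w0 (rcons q s).
Proof.
move=> /longest_inv/longest_left h /h[q /reduced_rev].
by rewrite invgK rev_cons; exists (rev q).
Qed.
End CoxeterWords.

Import Order.TTheory GRing.Theory Num.Theory.
Import numFieldTopology.Exports numFieldNormedType.Exports.

Local Open Scope classical_set_scope.
Local Open Scope ring_scope.

(** * Running infima and Pitman's identity *)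

Section Infimum.
Variable R : realType.
Implicit Types (h Z H : R -> R) (q p t u c : R).

Definition winf h q p : R := inf [set h u | u in `[q, p]].

(** Carried along because [inf] of a set without lower bound is a default value. *)
Definition lbdd h q p := exists c, forall u, q <= u <= p -> c <= h u.

Lemma lbddW h q p q' p' : lbdd h q p -> q <= q' -> p' <= p -> lbdd h q' p'.
Proof.
move=> [c hc] qq' pp'; exists c => u /andP[u1 u2]; apply: hc.
by rewrite (le_trans qq')// (le_trans u2).
Qed.

Lemma winf_le h q p u : lbdd h q p -> q <= u <= p -> winf h q p <= h u.
Proof.
move=> [c hc] hu; apply: ge_inf; last by exists u; rewrite //= in_itv.
by exists c => _ [v /= + <-]; rewrite in_itv /= => /hc.
Qed.

Lemma winf_ge h q p c : q <= p -> (forall u, q <= u <= p -> c <= h u) ->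
  c <= winf h q p.
Proof.
move=> qp hc; apply: lb_le_inf.
  by exists (h q), q => //=; rewrite in_itv /= lexx.
by move=> _ [v /= + <-]; rewrite in_itv /= => /hc.
Qed.

Lemma winf_lt h q p c : q <= p -> winf h q p < c -> exists2 u, q <= u <= p & h
  u < c.
Proof.
move=> qp; rewrite ltNge => hlt; apply: contrapT => hn; move/negP: hlt; apply.
apply: winf_ge => // u hu; rewrite leNgt; apply/negP => huc.
by apply: hn; exists u.
Qed.

Lemma eq_winf h H q p : (forall u, q <= u <= p -> h u = H u) -> winf h q p =
  winf H q p.
Proof.
move=> e; congr inf; rewrite eqEsubset.
by split=> _ [v /= + <-]; rewrite in_itv /= => hv; exists v;
  rewrite /= ?in_itv ?e.
Qed.

Lemma winf_eq h q p c : q <= p -> (forall u, q <= u <= p -> c <= h u) ->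
  (forall e, 0 < e -> exists2 u, q <= u <= p & h u < c + e) -> winf h q p = c.
Proof.
move=> qp h1 h2; apply/eqP; rewrite eq_le winf_ge// andbT.
apply/ler_addgt0Pr => e /h2[u hu lt]; apply: le_trans (ltW lt).
by apply: winf_le => //; exists c.
Qed.

Lemma winfD h q p c : lbdd h q p -> q <= p ->
  winf (fun u => h u + c) q p = winf h q p + c.
Proof.
move=> hb qp; apply: winf_eq => // [u hu|e e0]; first by rewrite lerD2r winf_le.
have [|u hu lt] := @winf_lt h q p (winf h q p + e) qp; first by rewrite ltrDl.
by exists u => //; rewrite addrAC ltrD2r.
Qed.

Lemma winfZ h q p c : lbdd h q p -> q <= p -> 0 <= c ->
  winf (fun u => c * h u) q p = c * winf h q p.
Proof.
move=> hb qp; rewrite le_eqVlt => /predU1P[<-|c0].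
  apply: winf_eq => // [u _|e e0]; rewrite !mul0r// add0r.
  by exists q; rewrite ?lexx ?mul0r.
apply: winf_eq => // [u hu|e e0]; first by rewrite ler_pM2l// winf_le.
have [|u hu lt] := @winf_lt h q p (winf h q p + e / c) qp.
  by rewrite ltrDl divr_gt0.
move: lt; rewrite -(ltr_pM2l c0) mulrDr mulrCA divff ?gt_eqF// mulr1.
by exists u.
Qed.

Lemma winf1 h t : winf h t t = h t.
Proof.
apply: winf_eq => // [u|e e0]; first by rewrite -eq_le => /eqP->.
by exists t; rewrite ?lexx ?ltrDl.
Qed.

Lemma winf_mono h q p q' p' : lbdd h q p -> q <= q' -> p' <= p -> q' <= p' ->
  winf h q p <= winf h q' p'.
Proof.
move=> hb qq pp qp; apply: winf_ge => // u /andP[u1 u2]; apply: winf_le => //.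
by rewrite (le_trans qq)// (le_trans u2).
Qed.

Lemma winf_split h q m p : lbdd h q p -> q <= m <= p ->
  winf h q p = Num.min (winf h q m) (winf h m p).
Proof.
move=> hb /andP[qm mp]; apply/eqP; rewrite eq_le; apply/andP; split.
  by rewrite le_min !winf_mono.
apply: winf_ge => [|u /andP[u1 u2]]; first exact: le_trans mp.
rewrite ge_min; have [um|mu] := leP u m.
  by rewrite winf_le ?u1//; apply: (lbddW hb).
by rewrite orbC winf_le ?(ltW mu)//; apply: (lbddW hb).
Qed.

Lemma winf_rev h q p c : winf (fun u => h (c - u)) q p = winf h (c - p) (c - q).
Proof.
congr inf; rewrite eqEsubset; split=> _ [v /= + <-]; rewrite in_itv /= =>
  /andP[v1 v2].
  by exists (c - v) => //=; rewrite in_itv /=; lra.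
by exists (c - v); rewrite ?subKr//= in_itv /=; lra.
Qed.

(** An epsilon-delta form of continuity on the segment, which avoids the subspace topology. *)
Definition edcont T Z := forall x, 0 <= x <= T -> forall e, 0 < e ->
  exists2 d, 0 < d & forall y, 0 <= y <= T -> `|x - y| < d -> `|Z x - Z y| < e.

Lemma edcontP T Z : {within `[0, T], continuous Z} <-> edcont T Z.
Proof.
rewrite subspace_continuousP; split=> [hc x xT e e0|hc x].
  have /cvgrPdist_lt/(_ e e0) : Z @ within `[0, T] (nbhs x) --> Z x.
    by apply: hc; rewrite /= in_itv.
  rewrite near_withinE => /nbhs_ballP[d d0 hd]; exists d => // y yT xy.
  by apply: hd => //=; rewrite in_itv.
rewrite /= in_itv => xT; apply/cvgrPdist_lt => e e0; rewrite near_withinE.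
have [d d0 hd] := hc x xT e e0.
by apply/nbhs_ballP; exists d => // y xy /=; rewrite in_itv /= => yT; exact: hd.
Qed.

Lemma edcont_lbdd T Z : 0 <= T -> edcont T Z -> lbdd Z 0 T.
Proof.
move=> T0 /edcontP /(EVT_min T0)[c _ hc].
by exists (Z c) => u uT; apply: hc; rewrite in_itv.
Qed.

Variables (T : R) (Z : R -> R).
Hypothesis cZ : edcont T Z.

Let I t := winf Z 0 t.

(** For [s <= t] near [x], either [I t = I s] or [I t] is the infimum over [[s, t]], where [Z] stays
    close to [Z s >= I s]. *)
Lemma edcont_winf : edcont T I.
Proof.
move=> x xT e e0; have [d d0 hd] := cZ xT (divr_gt0 e0 (ltr0n R 3)).
have lb : lbdd Z 0 T.
  by apply: edcont_lbdd => //; case/andP: xT => /le_trans; apply.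
have key s t : 0 <= s <= T -> 0 <= t <= T -> s <= t -> `|x - s| < d -> `|x - t|
  < d ->
    I t <= I s < I t + e.
  move=> /andP[s0 sT] /andP[t0 tT] st xs xt.
  have lbt : lbdd Z 0 t by apply: (lbddW lb).
  rewrite winf_mono//= /I (@winf_split Z 0 s t) ?s0//= minElt.
  case: ifP => _; first by rewrite ltrDl.
  apply: (@le_lt_trans _ _ (Z s)); first by rewrite winf_le ?s0 ?lexx//;
    apply: (lbddW lb).
  rewrite -ltrBlDr.
  apply: (@lt_le_trans _ _ (Z x - e / 3%:R)); last first.
    apply: winf_ge => // u /andP[su ut]; have u0 := le_trans s0 su.
    have : `|Z x - Z u| < e / 3%:R.
      apply: hd; first by rewrite u0 (le_trans ut).
      by move: xs xt; rewrite !ltr_norml; lra.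
    by rewrite ltr_norml; lra.
  have : `|Z x - Z s| < e / 3%:R by apply: hd; rewrite // s0.
  by rewrite ltr_norml; lra.
exists d => // y yT xy; have xx : `|x - x| < d by rewrite subrr normr0.
rewrite ltr_norml; have [xley|/ltW ylex] := leP x y.
  by have := key x y xT yT xley xx xy; lra.
by have := key y x yT xT ylex xy xx; lra.
Qed.

(* Pitman's identity. Either I is constant on [q, p], or Z meets the value I q
   at a point of [q, p] where I still equals I q. *)
Lemma pitman_identity q p : 0 <= q -> q <= p -> p <= T ->
  winf (fun s => Z s - 2 * I s) q p = winf Z q p - I q - I p.
Proof.
move=> q0 qp pT; have p0 := le_trans q0 qp.
have lb : lbdd Z 0 T by apply: edcont_lbdd => //; exact: le_trans pT.
have lbp : lbdd Z 0 p by apply: (lbddW lb).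
have Imono s t : 0 <= s -> s <= t -> t <= T -> I t <= I s.
  by move=> s0 st tT; apply: winf_mono => //; apply: (lbddW lb).
have IZ s : 0 <= s <= T -> I s <= Z s.
  move=> /andP[s0 sT]; apply: winf_le; rewrite ?s0 ?lexx//.
  by apply: (lbddW lb).
have [eqI|neI] := eqVneq (I p) (I q).
  have Ic s : q <= s <= p -> I s = I q.
    move=> /andP[qs sp]; apply/eqP; rewrite eq_le Imono ?(le_trans sp)//=.
    by rewrite -eqI Imono// (le_trans q0).
  rewrite (@eq_winf _ (fun s => Z s + (- 2 * I q))); last first.
    by move=> u /Ic ->; rewrite mulNr.
  rewrite winfD//; last by apply: (lbddW lb).
  by rewrite eqI; ring.
have ltI : I p < I q by rewrite lt_neqAle neI Imono.
have -> : winf Z q p = I p.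
  have : I p = Num.min (I q) (winf Z q p) by apply: winf_split; rewrite // q0.
  by rewrite minElt; case: ifP => // _ e; rewrite e ltxx in ltI.
have qT : q <= T by exact: le_trans pT.
(* [inf E] is the first time after [q] at which [Z] passes below the level [I q]; by continuity [Z]
   takes the value [I q] there. *)
pose E := [set u | q <= u <= p /\ Z u < I q].
have E0 : E !=set0.
  have [u /andP[u0 up] hu] := winf_lt p0 ltI; exists u; split=> //.
  rewrite up andbT leNgt; apply/negP => uq; move: hu; rewrite ltNge => /negP;
    apply.
  by apply: winf_le; rewrite ?u0 ?(ltW uq)//; apply: (lbddW lb).
have Elb : lbound E q by move=> u [] /andP[].
have Ehlb : has_lbound E by exists q.
have qs : q <= inf E by apply: lb_le_inf.
have sp : inf E <= p.
  by have [u hu] := E0; apply: le_trans (ge_inf Ehlb hu) _; case: hu => /andP[].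
have s0 : 0 <= inf E by exact: le_trans qs.
have sT : inf E <= T by exact: le_trans pT.
have ltE u : 0 <= u -> u < inf E -> I q <= Z u.
  move=> u0 us; have [uq|qu] := leP u q.
    by apply: winf_le; rewrite ?u0//; apply: (lbddW lb).
  rewrite leNgt; apply/negP => hu.
  have : inf E <= u by apply: ge_inf => //; split=> //;
    rewrite !ltW// (lt_le_trans us).
  by rewrite leNgt us.
have sTT : 0 <= inf E <= T by rewrite s0.
have Zs_ge : I q <= Z (inf E).
  move: qs; rewrite le_eqVlt => /predU1P[<-|qs]; first by apply: IZ; rewrite q0.
  rewrite leNgt; apply/negP => hlt.
  have [|d d0 hd] := cZ sTT (e := I q - Z (inf E)); first by rewrite subr_gt0.
  pose u := Num.max q (inf E - d / 2).
  have us : u < inf E by rewrite gt_max qs /=; lra.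
  have u0 : 0 <= u by rewrite le_max q0.
  have hu : inf E - d / 2 <= u by rewrite le_max lexx orbT.
  have /hd : 0 <= u <= T by rewrite u0 (le_trans (ltW us)).
  rewrite !ltr_norml => h; have := ltE u u0 us.
  by have := h ltac:(lra); lra.
have Zs_le : Z (inf E) <= I q.
  rewrite leNgt; apply/negP => hlt.
  have [|d d0 hd] := cZ sTT (e := Z (inf E) - I q); first by rewrite subr_gt0.
  have [u hu lt] := inf_lt E0 (x := inf E + d) ltac:(by rewrite ltrDl).
  have le := ge_inf Ehlb hu; case: hu => /andP[u1 u2] u3.
  have /hd : 0 <= u <= T by rewrite (le_trans q0)// (le_trans u2).
  by rewrite !ltr_norml => h; have := h ltac:(lra); lra.
have Is : I (inf E) = I q.
  apply/eqP; rewrite eq_le Imono//=; apply: winf_ge => // u /andP[u0].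
  by rewrite le_eqVlt => /predU1P[->|/ltE]; last exact.
(* The infimum is [- I q]: a lower bound since [I <= Z] and [I <= I q] on [[q, p]], and attained at
   [inf E]. *)
apply: winf_eq => // [u /andP[u1 u2]|e e0].
  have u0 := le_trans q0 u1; have uT := le_trans u2 pT.
  have := IZ u; rewrite u0 uT => /(_ isT).
  by have := Imono q u q0 u1 uT; lra.
by exists (inf E); rewrite ?qs ?sp// Is; lra.
Qed.
End Infimum.

Section LowerBounds.
Variable R : realType.
Implicit Types (h Z H : R -> R) (q p t u c : R).

Lemma lbddD h H q p : lbdd h q p -> lbdd H q p -> lbdd (fun u => h u + H u) q p.
Proof. by move=> [a ha] [b hb]; exists (a + b) => u hu; rewrite lerD ?ha ?hb.
  Qed.

Lemma lbddZ h q p c : 0 <= c -> lbdd h q p -> lbdd (fun u => c * h u) q p.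
Proof. by move=> c0 [a ha]; exists (c * a) => u /ha; exact: ler_wpM2l. Qed.

Lemma lbdd_winf h t : lbdd h 0 t -> lbdd (fun u => winf h 0 u) 0 t.
Proof.
move=> [a ha]; exists a => u /andP[u0 ut]; apply: winf_ge => // v /andP[v0 vu].
by apply: ha; rewrite v0 (le_trans vu).
Qed.

Lemma le_winfZ h q p c a : lbdd h q p -> q <= p -> 0 <= c ->
  (forall u, q <= u <= p -> a <= c * h u) -> a <= c * winf h q p.
Proof. by move=> hb qp c0 ha; rewrite -winfZ//; apply: winf_ge. Qed.

Lemma winf_cst q p c : q <= p -> winf (fun=> c) q p = c.
Proof.
by move=> qp; apply: winf_eq => // e e0; exists q; rewrite ?lexx// ltrDl.
Qed.

End LowerBounds.

Section TwoStep.
Variables (R : realType) (T : R) (Z : R -> R).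
Hypothesis cZ : edcont T Z.
Let I t := winf Z 0 t.

Lemma lbdd_pitman : 0 <= T -> lbdd (fun s => Z s - 2 * I s) 0 T.
Proof.
move=> T0; have lb := edcont_lbdd T0 cZ.
apply: lbddD => //; exists (- (2 * Z 0)) => u /andP[u0 uT].
by rewrite lerN2 ler_pM2l// winf_le ?lexx//; apply: (lbddW lb).
Qed.

(* For a fixed inner time q, Pitman's identity on [q, p] eliminates s. *)
Lemma winf_two_step c H p : 0 <= c -> lbdd H 0 T -> 0 <= p <= T ->
  winf (fun s => c * (Z s - 2 * I s) + winf (fun q => c * I q + H q) 0 s) 0 p =
  winf (fun s => c * Z s + winf H 0 s) 0 p - c * I p.
Proof.
move=> c0 lbH /andP[p0 pT]; have T0 := le_trans p0 pT.
have lbZ := edcont_lbdd T0 cZ; have lbZI := lbdd_pitman T0.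
have lbI := lbdd_winf lbZ.
have lbIH : lbdd (fun q => c * I q + H q) 0 T by apply: lbddD => //;
  apply: lbddZ.
apply/eqP; rewrite eq_le; apply/andP; split.
- rewrite lerBrDr; apply: winf_ge => // s /andP[s0 sp].
  rewrite -lerBlDl; apply: winf_ge => // q /andP[q0 qs].
  have qp := le_trans qs sp; rewrite lerBlDl.
  set L := winf _ 0 p.
  have le1 : L - c * I q - H q <= c * winf (fun s => Z s - 2 * I s) q p.
    apply: le_winfZ => //; first exact: (lbddW lbZI).
    move=> u /andP[qu up]; rewrite -addrA -opprD lerBlDr.
    apply: (@le_trans _ _ (c * (Z u - 2 * I u) + winf (fun q =>
      c * I q + H q) 0 u)).
      apply: winf_le; last by rewrite up (le_trans q0).
      apply: (@lbddW _ _ 0 T) => //; apply: lbddD; first exact: lbddZ.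
      exact: lbdd_winf.
    rewrite lerD2l; apply: winf_le; rewrite ?q0//.
    by apply: (lbddW lbIH) => //; exact: le_trans pT.
  have le2 : c * winf Z q p <= c * Z s.
    by apply: ler_wpM2l => //; apply: winf_le; rewrite ?qs//;
      exact: (lbddW lbZ).
  by move: le1; rewrite (pitman_identity cZ)// -/(I q) -/(I p); lra.
- apply: winf_ge => // s /andP[s0 sp].
  rewrite -lerBlDl; apply: winf_ge => // q /andP[q0 qs].
  have qp := le_trans qs sp; rewrite lerBlDl.
  set L := winf _ 0 p.
  have le1 : L - H q <= c * winf Z q p.
    apply: le_winfZ => //; first exact: (lbddW lbZ).
    move=> u /andP[qu up]; rewrite lerBlDr.
    apply: (@le_trans _ _ (c * Z u + winf H 0 u)).
      apply: winf_le; last by rewrite up (le_trans q0).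
      apply: (@lbddW _ _ 0 T) => //; apply: lbddD; first exact: lbddZ.
      exact: lbdd_winf.
    rewrite lerD2l; apply: winf_le; rewrite ?q0//.
    by apply: (lbddW lbH) => //; exact: le_trans pT.
  have le2 : c * winf (fun s => Z s - 2 * I s) q p <= c * (Z s - 2 * I s).
    apply: ler_wpM2l => //; apply: winf_le; rewrite ?qs//.
    exact: (lbddW lbZI).
  by move: le2; rewrite (pitman_identity cZ)// -/(I q) -/(I p); lra.
Qed.

End TwoStep.

(** * Nested infima with Chebyshev weights *)

Section Nested.
Variables (R : realType) (T : R) (Tc : nat -> R) (rho : R) (N : nat).
Hypothesis T0 : 0 <= T.
Hypothesis Tc_ge0 : forall i, (i < N)%N -> 0 <= Tc i.
Hypothesis Tc0 : Tc 0 = 1.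
Hypothesis Tc1 : Tc 1 = rho.
Hypothesis TcS : forall i, Tc i.+2 = rho * Tc i.+1 - Tc i.

(* The infimum of Tc_i Z(s_0) + Tc_(i+1) Y(s_1) + Tc_(i+2) Z(s_2) + ..., with
   k terms, over t >= s_0 >= s_1 >= ... >= 0. *)
Fixpoint nest i k (Z Y : R -> R) (t : R) : R :=
  if k is k'.+1 then winf (fun u => Tc i * Z u + nest i.+1 k' Y Z u) 0 t else 0.

Lemma eq_nest i k (Z Z' Y Y' : R -> R) : (forall u, 0 <= u <= T -> Z u = Z' u)
  ->
  (forall u, 0 <= u <= T -> Y u = Y' u) ->
  forall t, 0 <= t <= T -> nest i k Z Y t = nest i k Z' Y' t.
Proof.
elim: k i Z Z' Y Y' => // k IH i Z Z' Y Y' eZ eY t /andP[t0 tT] /=.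
apply: eq_winf => u /andP[u0 ut].
have uT : 0 <= u <= T by rewrite u0 (le_trans ut).
by rewrite eZ// (IH _ Y Y' Z Z').
Qed.

Lemma lbdd_nest i k Z Y : (i + k <= N)%N -> lbdd Z 0 T -> lbdd Y 0 T ->
  lbdd (nest i k Z Y) 0 T.
Proof.
elim: k i Z Y => [|k IH] i Z Y ik hZ hY; first by exists 0.
apply: lbdd_winf; apply: lbddD; last by apply: IH; rewrite // addSnnS.
by apply: lbddZ => //; apply: Tc_ge0; apply: leq_trans ik;
  rewrite addnS ltnS leq_addr.
Qed.

Lemma nest_last i k Z Y t : Tc (i + k) = 0 -> 0 <= t ->
  nest i k.+1 Z Y t = nest i k Z Y t.
Proof.
elim: k i Z Y t => [|k IH] i Z Y t e t0.
  rewrite addn0 in e; rewrite /= -[RHS](winf_cst _ t0); apply: eq_winf => u _.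
  by rewrite e mul0r addr0.
rewrite [RHS]/= [LHS]/=; apply: eq_winf => u /andP[u0 _].
by congr (_ + _); apply: IH; rewrite // addSnnS.
Qed.

Variables (Z Y : R -> R).
Hypothesis cZ : edcont T Z.
Hypothesis cY : edcont T Y.
Let I t := winf Z 0 t.
Let Z' u := Z u - 2 * I u.
Let Y' u := Y u + rho * I u.

(** By induction and [winf_two_step] with [c = Tc i]: the coefficient of [I] in the inner infimum is
    [rho * Tc i.+1 - Tc i.+2], which the recurrence turns into [Tc i]. *)
Lemma nest_even i j p : (i + j.*2 < N)%N -> 0 <= p <= T ->
  nest i j.*2 Z' Y' p = nest i j.*2.+1 Z Y p - Tc i * I p.
Proof.
have lbZ := edcont_lbdd T0 cZ; have lbY := edcont_lbdd T0 cY.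
elim: j i p => [|j IH] i p ijN /andP[p0 pT].
  rewrite addn0 in ijN; have Ti := Tc_ge0 ijN.
  rewrite /= (@eq_winf _ _ (fun u => Tc i * Z u)); last by move=> u _;
    rewrite addr0.
  by rewrite winfZ ?subrr//; exact: (lbddW lbZ).
have iN : (i < N)%N by apply: leq_ltn_trans ijN; exact: leq_addr.
pose H u := Tc i.+1 * Y u + nest i.+2 j.*2.+1 Z Y u.
transitivity (winf (fun s => Tc i * (Z s - 2 * I s) +
    winf (fun q => Tc i * I q + H q) 0 s) 0 p); last first.
  rewrite (winf_two_step cZ) ?p0//; first exact: Tc_ge0.
  apply: lbddD; last first.
    by apply: lbdd_nest => //; lia.
  apply: lbddZ => //; apply: Tc_ge0; lia.
rewrite doubleS /=; apply: eq_winf => u /andP[u0 up]; congr (_ + _).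
apply: eq_winf => q /andP[q0 qu].
rewrite IH; last 2 first.
- lia.
- by rewrite q0 (le_trans qu)// (le_trans up).
by rewrite TcS /H /Y'; ring.
Qed.

Lemma nest_odd j p : (j.*2.+1 < N)%N -> 0 <= p <= T ->
  nest 0 j.*2.+1 Y' Z' p = nest 0 j.*2.+2 Y Z p.
Proof.
move=> jN /andP[p0 pT]; rewrite -[LHS]/(winf (fun u =>
  Tc 0 * Y' u + nest 1 j.*2 Z' Y' u) 0 p).
rewrite -[RHS]/(winf (fun u => Tc 0 * Y u + nest 1 j.*2.+1 Z Y u) 0 p).
apply: eq_winf => u /andP[u0 up].
by rewrite nest_even ?u0 ?(le_trans up)// Tc1 Tc0 /Y'; ring.
Qed.

End Nested.

(** * Pitman transforms of paths *)

Section PathOperations.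
Variables (R : realType) (V : topologicalLmodType R) (T : R).
Implicit Types (p q : R -> V) (a : V) (t u : R).

Lemma within_sub p q : {within `[0, T], continuous p} ->
  {within `[0, T], continuous q} -> {within `[0, T], continuous (fun t =>
    p t - q t)}.
Proof.
rewrite !subspace_continuousP => hp hq x xT.
apply: (cvg_comp2 (hp x xT) (hq x xT) (h := fun x y => x - y)).
have := @sub_continuous V (p x, q x); exact.
Qed.

Lemma within_scale (f : R -> R) a : {within `[0, T], continuous f} ->
  {within `[0, T], continuous (fun t => f t *: a)}.
Proof.
rewrite !subspace_continuousP => hf x xT.
have ca : cst a @ within `[0, T] (nbhs x) --> a by exact: cvg_cst.
apply: (cvg_comp2 (hf x xT) ca (h := fun (x : R^o) y => x *: y)).
exact: (scale_continuous (f x : R^o, a)).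
Qed.

Lemma within_comp (U : topologicalType) (f : V -> U) p : continuous f ->
  {within `[0, T], continuous p} -> {within `[0, T], continuous (fun t =>
    f (p t))}.
Proof.
rewrite !subspace_continuousP => hf hp x xT.
by apply: (cvg_comp _ _ (hp x xT)); exact: hf.
Qed.

Lemma within_rev p : {within `[0, T], continuous p} ->
  {within `[0, T], continuous (fun t => p (T - t))}.
Proof.
rewrite !subspace_continuousP => hp x; rewrite /= in_itv => /= xT.
have xT' : `[0, T]%classic (T - x) by rewrite /= in_itv /=; lra.
apply: (@cvg_comp _ _ _ (fun t => T - t) p _ (within `[0, T] (nbhs (T - x))));
  last exact: hp.
move=> U; rewrite /within /= => hU.
have : continuous (fun t : R => T - t).
  by move=> y; exact: (@cvgB _ R R _ _ _ _ T y (cvg_cst T) cvg_id).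
move=> /(_ x _ hU); apply: (@filterS _ (nbhs x)) => y /= h;
  rewrite in_itv /= => yT.
by apply: h; rewrite in_itv /=; lra.
Qed.

Lemma is_path_edcont p (a' : {scalar V}) : is_path T p -> continuous (a' : V ->
  R) ->
  edcont T (fun u => a' (p u)).
Proof. by move=> [cp _] ca; apply/edcontP; apply: within_comp. Qed.

Lemma sub_collect (x y a : V) (i j k : R) :
  x - i *: a - (y - j *: a) - k *: a = x - y - (i - j + k) *: a.
Proof. by rewrite scalerDl scalerBl !opprD !opprK !addrA [x - _ - y]addrAC. Qed.

Lemma pitmanE a (a' : {scalar V}) p t : pitman a a' p t = p t - winf (fun u =>
  a' (p u)) 0 t *: a.
Proof. by []. Qed.

Lemma coroot_pitman a (a' b' : {scalar V}) p t :
  b' (pitman a a' p t) = b' (p t) - winf (fun u => a' (p u)) 0 t * b' a.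
Proof. by rewrite pitmanE linearB linearZ. Qed.

Lemma pitman_path a (a' : {scalar V}) p : continuous (a' : V -> R) -> is_path T
  p ->
  is_path T (pitman a a' p).
Proof.
move=> ca hp; have [cp p0] := hp; split; last first.
  by rewrite pitmanE winf1 p0 linear0 scale0r subr0.
apply: within_sub => //; apply: within_scale.
by apply/edcontP; apply: edcont_winf; exact: is_path_edcont.
Qed.

Lemma kappa_path p : 0 <= T -> is_path T p -> is_path T (kappa T p).
Proof.
move=> T0 [cp p0]; split; last by rewrite /kappa subr0 subrr.
apply: within_sub; first exact: within_rev.
by apply: continuous_subspaceT => x; exact: cvg_cst.
Qed.

Lemma path_eq_sym p q : path_eq T p q -> path_eq T q p.
Proof. by move=> h t /h. Qed.

Lemma path_eq_trans p q r : path_eq T p q -> path_eq T q r -> path_eq T p r.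
Proof. by move=> h1 h2 t tT; rewrite h1// h2. Qed.

Lemma pitman_eq a (a' : {scalar V}) p q : path_eq T p q -> path_eq T (pitman a
  a' p) (pitman a a' q).
Proof.
move=> e t /andP[t0 tT]; rewrite !pitmanE e ?t0//; congr (_ - _ *: _).
by apply: eq_winf => u /andP[u0 ut]; rewrite e// u0 (le_trans ut).
Qed.

Lemma kappa_eq p q : path_eq T p q -> path_eq T (kappa T p) (kappa T q).
Proof. by move=> e t tT; rewrite /kappa !e//; lra. Qed.

Lemma kappaK p t : p 0 = 0 -> kappa T (kappa T p) t = p t.
Proof. by move=> p0; rewrite /kappa subKr subrr p0 sub0r opprK subrK. Qed.

(** Positive factors come out of the infimum. This is what allows roots to be normalised in the
    braid relations. *)
Lemma pitman_scale a (a' : {scalar V}) p k t : is_path T p -> continuous (a' :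
  V -> R) ->
  0 < k -> 0 <= t <= T -> pitman (k *: a) (k^-1 \*: a') p t = pitman a a' p t.
Proof.
move=> hp ca k0 /andP[t0 tT].
rewrite !pitmanE /= winfZ ?invr_ge0 ?(ltW k0)//; last first.
  by apply: (lbddW (edcont_lbdd (le_trans t0 tT) (is_path_edcont hp ca))).
by rewrite scalerA mulrAC mulVf ?mul1r ?gt_eqF.
Qed.

(* By Pitman's identity. *)
Lemma pitman_kappa a (a' : {scalar V}) p : continuous (a' : V -> R) -> a' a = 2
  -> is_path T p ->
  path_eq T (pitman a a' (kappa T (pitman a a' p))) (pitman a a' (kappa T p)).
Proof.
move=> ca ea hp t /andP[t0 tT]; have T0 := le_trans t0 tT.
pose X u := a' (p u); pose I u := winf X 0 u.
have cX : edcont T X by exact: is_path_edcont.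
have lb := edcont_lbdd T0 cX.
have Tt : 0 <= T - t by rewrite subr_ge0.
have tT' : T - t <= T by rewrite gerBl.
rewrite !pitmanE.
have -> : winf (fun u => a' (kappa T p u)) 0 t = winf X (T - t) T - X T.
  rewrite (@eq_winf _ _ (fun u => X (T - u) - X T)); last first.
    by move=> u _; rewrite /kappa linearB.
  rewrite winfD//; first by rewrite (winf_rev X) subr0.
  have [c hc] := lb; exists c => u ut; apply: hc; lra.
have -> : winf (fun u => a' (kappa T (pitman a a' p) u)) 0 t =
    winf X (T - t) T - I (T - t) - X T + I T.
  rewrite (@eq_winf _ _ (fun u => (X (T - u) - 2 * I (T - u)) - (X T - 2 * I
    T))).
    rewrite winfD//; first rewrite (winf_rev (fun u => X u - 2 * I u)) subr0.
      by rewrite (pitman_identity cX)// -/(I T) -/(I (T - t)); ring.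
    have [c hc] := lbdd_pitman cX T0; exists c => u ut; apply: hc; lra.
  by move=> u _; rewrite /kappa linearB !coroot_pitman -/(X T) -/(X (T - u))
    -/(I T) -/(I (T - u)) ea; ring.
rewrite /kappa !pitmanE -/(I T) -/(I (T - t)) sub_collect; congr (_ - _ *: _).
by ring.
Qed.

End PathOperations.

(** * Braid relations *)

Section RankTwo.
Variables (R : realType) (V : topologicalLmodType R) (T : R).
Variables (W : finGroupType) (alpha : W -> V) (coalpha : W -> {scalar V}).
Variables (s t : W) (N : nat) (Tc : nat -> R) (rho : R).
Hypothesis T0 : 0 <= T.
Hypothesis Tc_ge0 : forall i, (i < N)%N -> 0 <= Tc i.
Hypothesis Tc0 : Tc 0 = 1.
Hypothesis Tc1 : Tc 1 = rho.
Hypothesis TcS : forall i, Tc i.+2 = rho * Tc i.+1 - Tc i.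
Hypothesis cs : continuous (coalpha s : V -> R).
Hypothesis ct : continuous (coalpha t : V -> R).
Hypothesis hs : coalpha s (alpha s) = 2.
Hypothesis ht : coalpha t (alpha t) = 2.
Hypothesis hst : coalpha s (alpha t) = - rho.
Hypothesis hts : coalpha t (alpha s) = - rho.

Local Notation pw := (pitman_word alpha coalpha).
Local Notation P x := (pitman (alpha x) (coalpha x)).

(** Induction peels off the innermost transform, that is the last letter. Its effect on the two
    coordinates is the substitution treated in [nest_even] and [nest_odd], and its own correction to
    [p] cancels the extra term of [nest_even]. *)
Lemma pitman_alt n p u : (n <= N)%N -> is_path T p -> 0 <= u <= T ->
  pw (alt n s t) p u = p u
    - nest Tc 0 n (fun v => coalpha s (p v)) (fun v =>
      coalpha t (p v)) u *: alpha s
    - nest Tc 0 n.-1 (fun v => coalpha t (p v)) (fun v =>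
      coalpha s (p v)) u *: alpha t.
Proof.
elim: n p => [|n IH] p nN hp uT; first by rewrite !scale0r !subr0.
rewrite alt_rcons /pitman_word foldr_rcons -/(pw _ _).
pose X v := coalpha s (p v); pose Y v := coalpha t (p v).
have cX : edcont T X by exact: is_path_edcont.
have cY : edcont T Y by exact: is_path_edcont.
have := odd_double_half n; set k := n./2.
case: (odd n); rewrite ?add0n ?add1n => /esym nE.
- have eX v : coalpha s (P t p v) = X v + rho * winf Y 0 v.
    by rewrite coroot_pitman hst -/(X v); ring.
  have eY v : coalpha t (P t p v) = Y v - 2 * winf Y 0 v.
    by rewrite coroot_pitman ht -/(Y v); ring.
  rewrite IH ?(ltnW nN)//; last exact: pitman_path.
  rewrite (@eq_nest _ T _ 0 n _ (fun v => X v + rho * winf Y 0 v) _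
    (fun v => Y v - 2 * winf Y 0 v))//.
  rewrite (@eq_nest _ T _ 0 n.-1 _ (fun v => Y v - 2 * winf Y 0 v) _
    (fun v => X v + rho * winf Y 0 v))//.
  have -> : nest Tc 0 n (fun v => X v + rho * winf Y 0 v)
      (fun v => Y v - 2 * winf Y 0 v) u = nest Tc 0 n.+1 X Y u.
    by rewrite nE; apply: (nest_odd T0 Tc_ge0 Tc0 Tc1 TcS cY cX) => //;
      rewrite nE in nN.
  have -> : nest Tc 0 n.-1 (fun v => Y v - 2 * winf Y 0 v)
      (fun v => X v + rho * winf Y 0 v) u = nest Tc 0 n Y X u - Tc 0 * winf Y 0
        u.
    by rewrite nE; apply: (nest_even T0 Tc_ge0 TcS cY cX) => //; lia.
  rewrite Tc0 mul1r scalerBl pitmanE -/Y.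
  by rewrite opprB addrA [X in X + _ - _]addrAC subrK.
- have eX v : coalpha s (P s p v) = X v - 2 * winf X 0 v.
    by rewrite coroot_pitman hs -/(X v); ring.
  have eY v : coalpha t (P s p v) = Y v + rho * winf X 0 v.
    by rewrite coroot_pitman hts -/(Y v); ring.
  rewrite IH ?(ltnW nN)//; last exact: pitman_path.
  rewrite (@eq_nest _ T _ 0 n _ (fun v => X v - 2 * winf X 0 v) _
    (fun v => Y v + rho * winf X 0 v))//.
  rewrite (@eq_nest _ T _ 0 n.-1 _ (fun v => Y v + rho * winf X 0 v) _
    (fun v => X v - 2 * winf X 0 v))//.
  have -> : nest Tc 0 n (fun v => X v - 2 * winf X 0 v)
      (fun v => Y v + rho * winf X 0 v) u = nest Tc 0 n.+1 X Y u - Tc 0 * winf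
        X 0 u.
    by rewrite nE; apply: (nest_even T0 Tc_ge0 TcS cX cY) => //; lia.
  have -> : nest Tc 0 n.-1 (fun v => Y v + rho * winf X 0 v)
      (fun v => X v - 2 * winf X 0 v) u = nest Tc 0 n Y X u.
    rewrite nE in nN *; case: k {nE} nN => // k nN; rewrite doubleS.
    by apply: (nest_odd T0 Tc_ge0 Tc0 Tc1 TcS cX cY) => //; lia.
  rewrite Tc0 mul1r scalerBl pitmanE -/X; congr (_ - _).
  by rewrite opprB addrA subrK.
Qed.

End RankTwo.

Section Chebyshev.
Variables (R : realType) (m : nat).
Hypothesis m1 : (1 < m)%N.
Let th : R := pi / m%:R.

(* The value at cos (pi / m) of the i-th Chebyshev polynomial of the second
   kind. *)
Definition cheb i : R := sin (i.+1%:R * th) / sin th.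

Let m0 : (0 : R) < m%:R. Proof. by rewrite ltr0n ltnW. Qed.

Lemma sin_th_gt0 : 0 < sin th.
Proof.
apply: sin_gt0_pi; rewrite divr_gt0 ?pi_gt0//= ltr_pdivrMr// ltr_pMr ?pi_gt0//.
by rewrite ltr1n.
Qed.

Lemma cheb_ge0 i : (i < m)%N -> 0 <= cheb i.
Proof.
move=> im; rewrite divr_ge0 ?(ltW sin_th_gt0)// sin_ge0_pi//.
rewrite mulr_ge0 ?divr_ge0 ?pi_ge0 ?(ltW m0)//=.
by rewrite mulrCA -[leRHS]mulr1 ler_pM2l ?pi_gt0// ler_pdivrMr// mul1r ler_nat.
Qed.

Lemma cheb0 : cheb 0 = 1.
Proof. by rewrite /cheb mul1r divff// gt_eqF// sin_th_gt0. Qed.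

Lemma chebS i : cheb i.+2 = 2 * cos th * cheb i.+1 - cheb i.
Proof.
rewrite /cheb mulrA -mulrBl; congr (_ / _).
have -> : i.+3%:R * th = i.+2%:R * th + th by rewrite -addn1 natrD mulrDl mul1r.
have -> : i.+1%:R * th = i.+2%:R * th - th.
  by rewrite -[i.+2]addn1 natrD mulrDl mul1r addrK.
by rewrite sinD sinB; ring.
Qed.

Lemma cheb1 : cheb 1 = 2 * cos th.
Proof.
have s0 : sin th != 0 by rewrite gt_eqF// sin_th_gt0.
apply: (mulIf s0); rewrite /cheb -mulrA mulVf// mulr1 (_ : 2%:R * th = th +
  th); last by ring.
by rewrite sinD; ring.
Qed.

(** This is [sin pi = 0], the point where the order of [s t] enters the braid relation. *)
Lemma cheb_last : cheb m.-1 = 0.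
Proof.
have e : m%:R * th = pi by rewrite /th mulrC divfK// gt_eqF.
by rewrite /cheb prednK ?(ltnW m1)// e sinpi mul0r.
Qed.

Lemma cos_th_ge0 : 0 <= cos th.
Proof.
apply: cos_ge0_pihalf; rewrite (@le_trans _ _ 0) ?divr_ge0 ?pi_ge0 ?(ltW m0)//=.
  by rewrite ler_pM2l ?pi_gt0// lef_pV2 ?posrE// ler_nat.
by rewrite oppr_le0 divr_ge0 ?pi_ge0.
Qed.

End Chebyshev.

(** Either both pairings vanish, or [k = - c / a] works because [b = c^2 / a]. *)
Lemma normalize_roots (R : realType) (a b c : R) : a <= 0 -> 0 <= c -> (a = 0
  <-> b = 0) ->
  a * b = c ^+ 2 -> exists k, [/\ 0 < k, k * a = - c & k^-1 * b = - c].
Proof.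
move=> a0 c0 ab0 ab; have [ea|na] := eqVneq a 0.
  have eb : b = 0 by apply/ab0.
  have -> : c = 0 by apply/eqP; rewrite -sqrf_eq0 -ab ea mul0r.
  by exists 1; rewrite ltr01 ea eb !mulr0 oppr0.
have alt0 : a < 0 by rewrite lt_neqAle na.
have cn0 : c != 0.
  apply: contra_neq na => ec; move/eqP: ab; rewrite ec expr0n mulf_eq0 =>
    /orP[/eqP//|].
  by move=> /eqP /ab0.
have cgt0 : 0 < c by rewrite lt_neqAle eq_sym cn0.
exists (- c / a); split.
- by rewrite ltr_ndivlMr// mul0r oppr_lt0.
- by rewrite divfK.
- have -> : b = c ^+ 2 / a by rewrite -ab mulrC mulKf.
  by field; rewrite na cn0.
Qed.

Section Braid.
Variables (R : realType) (V : topologicalLmodType R) (T : R).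
Variables (W : finGroupType) (S : {set W}) (rho : W -> {linear V -> V}).
Variables (alpha : W -> V) (coalpha : W -> {scalar V}).
Hypothesis T0 : 0 <= T.
Hypothesis hWS : coxeter_system S.
Hypothesis hroots : simple_roots S rho alpha coalpha.

Lemma coroot_continuous s : s \in S -> continuous (coalpha s : V -> R).
Proof. by case: hroots => h _ _ _ /h. Qed.

Lemma coroot_root s : s \in S -> coalpha s (alpha s) = 2.
Proof. by case: hroots => _ h _ _ /h. Qed.

Local Notation pw := (pitman_word alpha coalpha).

Lemma pitman_word_path r p : words S r -> is_path T p -> is_path T (pw r p).
Proof.
elim: r => //= s r IH /words_cons[sS rS] hp; apply: pitman_path; last exact: IH.
exact: coroot_continuous.
Qed.

Lemma pitman_word_eq r p q : path_eq T p q -> path_eq T (pw r p) (pw r q).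
Proof. by elim: r => //= s r IH /IH; exact: pitman_eq. Qed.

Lemma pitman_word_cat r q p : pw (r ++ q) p = pw r (pw q p).
Proof. exact: foldr_cat. Qed.

Lemma pitman_braid s t p : s \in S -> t \in S -> s != t -> is_path T p ->
  path_eq T (pw (alt #[s * t]%g s t) p) (pw (alt #[s * t]%g t s) p).
Proof.
move=> sS tS st hp.
have m1 := coxeter_order_gt1 hWS sS tS st; set m := #[_]%g in m1 *.
have [le0 eq0 prod] : [/\ coalpha s (alpha t) <= 0,
    coalpha s (alpha t) = 0 <-> coalpha t (alpha s) = 0 &
    coalpha s (alpha t) * coalpha t (alpha s) = (2 * cos (pi / m%:R)) ^+ 2].
  by case: hroots => _ _ _ /(_ s t sS tS st)[? ? e]; split=> //; rewrite e;
    ring.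
pose c := 2 * cos (pi / m%:R) : R.
have c0 : 0 <= c by rewrite mulr_ge0// cos_th_ge0.
have [k [k0 ka kb]] := normalize_roots le0 c0 eq0 prod.
(* Rescaling only the root and coroot of [t] keeps the transforms and makes both mutual pairings
   equal to [- 2 cos (pi / m)]. *)
pose al x := if x == t then k *: alpha t else alpha x.
pose co x : {scalar V} := if x == t then (k^-1 \*: coalpha t : {scalar V}) else
  coalpha x.
have als : al s = alpha s by rewrite /al (negbTE st).
have alt' : al t = k *: alpha t by rewrite /al eqxx.
have cos' : co s = coalpha s by rewrite /co (negbTE st).
have cot : co t = k^-1 \*: coalpha t by rewrite /co eqxx.
pose D : {set W} := [set s; t]%SET.
have cco x : x \in D -> continuous (co x : V -> R).
  rewrite !inE => /orP[]/eqP->; first by rewrite cos'; exact: coroot_continuous.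
  rewrite cot => v; apply: (@cvgM R V _ _ (fun=> k^-1) (coalpha t)).
    exact: cvg_cst.
  exact: coroot_continuous.
have st_words r : words D r -> words S r.
  by move=> h x /h; rewrite !inE => /orP[]/eqP->.
have pwE r : words D r -> path_eq T (pw r p) (pitman_word al co r p).
  elim: r => // x r IH /words_cons[xst rst].
  apply: (@path_eq_trans _ _ _ _ (pitman (al x) (co x) (pw r p))); last first.
    exact/pitman_eq/IH.
  move=> u uT; move: xst; rewrite !inE => /orP[]/eqP->;
    first by rewrite als cos'.
  rewrite alt' cot (pitman_scale (T := T))//; last exact: coroot_continuous.
  by apply: pitman_word_path => //; exact: st_words.
have alt_st n x y : x \in D -> y \in D -> words D (alt n x y).
  exact: words_alt.
have sst : s \in D by rewrite !inE eqxx.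
have tst : t \in D by rewrite !inE eqxx orbT.
move=> u uT; rewrite !pwE; last 4 first.
- exact: alt_st.
- exact: uT.
- exact: alt_st.
- exact: uT.
have ns : co s (al s) = 2 by rewrite als cos' coroot_root.
have nt : co t (al t) = 2.
  rewrite alt' cot -[LHS]/(k^-1 * coalpha t (k *: alpha t)) scalarZ
    coroot_root//.
  by rewrite mulKf// gt_eqF.
have nst : co s (al t) = - c by rewrite cos' alt' scalarZ.
have nts : co t (al s) = - c by rewrite cot als.
have C0 := @cheb_ge0 R m m1; have C1 := cheb0 R m1.
have C2 := cheb1 R m1; have C3 := @chebS R m; have C4 := @cheb_last R m m1.
rewrite (pitman_alt T0 C0 C1 C2 C3 (cco s sst) (cco t tst) ns nt nst nts)//.
rewrite (pitman_alt T0 C0 C1 C2 C3 (cco t tst) (cco s sst) nt ns nts nst)//.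
have [u0 _] := andP uT.
(* The innermost of the [m] levels has weight [cheb m.-1 = 0]. Dropping it leaves [m - 1] levels in
   both coefficients, so the formula is symmetric in [s] and [t]. *)
have eN X Y : nest (cheb R m) 0 m X Y u = nest (cheb R m) 0 m.-1 X Y u.
  by have := @nest_last _ (cheb R m) 0 m.-1 X Y u C4 u0; rewrite prednK// ltnW.
by rewrite !eN addrAC.
Qed.
End Braid.

(** * The reflection representation *)

Lemma avoid_seq (R : realType) (B : seq R) : exists c, c \notin B.
Proof.
exists (1 + \sum_(b <- B) `|b|); apply/negP => cB.
suff : 1 + \sum_(b <- B) `|b| <= \sum_(b <- B) `|b| by rewrite gerDr leNgt
  ltr01.
apply: le_trans (ler_norm _) _; rewrite [leRHS](big_rem _ cB) /= lerDl.
by apply: sumr_ge0.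
Qed.

Section Vectors.
Variables (R : realType) (V : topologicalLmodType R).
Variables (W : finGroupType) (S : {set W}) (rho : W -> {linear V -> V}).
Variables (alpha : W -> V) (coalpha : W -> {scalar V}).
Hypothesis hWS : coxeter_system S.
Hypothesis hW : linear_group rho.
Hypothesis hroots : simple_roots S rho alpha coalpha.
Implicit Types (x y v : V) (s t w u : W) (r q : seq W).

Local Notation prodw r := (\prod_(s <- r) s)%g.
Local Notation pw := (pitman_word alpha coalpha).

Lemma rho1 x : rho 1%g x = x. Proof. by case: hW. Qed.
Lemma rhoM u w x : rho (u * w)%g x = rho u (rho w x). Proof. by case: hW. Qed.
Lemma rho_inj u w : rho u =1 rho w -> u = w. Proof. by case: hW => _ _; apply.
  Qed.
Lemma rhoBZ w x y (c : R) : rho w (x - c *: y) = rho w x - c *: rho w y.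
Proof. by rewrite linearB linearZ. Qed.
Lemma rhoK w x : rho w^-1%g (rho w x) = x.
Proof. by rewrite -rhoM mulVg rho1. Qed.
Lemma rho_refl s x : s \in S -> rho s x = x - coalpha s x *: alpha s.
Proof. by case: hroots => _ _ h _ /h. Qed.
(** The effect of a Pitman transform on a straight line: [x] is reflected when it lies on the
    negative side of the wall of [s], and kept otherwise. *)
Definition fold_vec s x := x - Num.min 0 (coalpha s x) *: alpha s.
Definition fold_vec_word r x := foldr fold_vec x r.
Definition vdominant x := {in S, forall s, 0 <= coalpha s x}.

Definition line x (t : R) := t *: x.

Lemma line_path T x : is_path T (line x).
Proof.
split; last by rewrite /line scale0r.
by apply: within_scale; apply: continuous_subspaceT => u; exact: cvg_id.
Qed.

Lemma winf_linear (c u : R) : 0 <= u -> winf (fun a : R =>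
  a * c) 0 u = u * Num.min 0 c.
Proof.
move=> u0; apply: winf_eq => // [v /andP[v0 vu]|e e0].
  have [c0|c0] := leP 0 c; first by rewrite mulr0 mulr_ge0.
  by rewrite ler_wnM2r// ltW.
have [c0|c0] := leP 0 c; first by exists 0; rewrite ?lexx// mul0r mulr0 add0r.
by exists u; rewrite ?u0 ?lexx// ltrDl.
Qed.

Lemma pitman_line s x (u : R) : 0 <= u ->
  pitman (alpha s) (coalpha s) (line x) u = line (fold_vec s x) u.
Proof.
move=> u0; rewrite pitmanE /line (@eq_winf R _ (fun a : R => a * coalpha s x)).
  by rewrite winf_linear// scalerBr scalerA.
by move=> v _; rewrite scalarZ.
Qed.

Lemma pitman_word_line r x (u : R) : 0 <= u -> pw r (line x) u = line
  (fold_vec_word r x) u.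
Proof.
elim: r u => // s r IH u u0 /=.
rewrite -pitman_line//; apply: (@pitman_eq _ _ u); last by rewrite u0 lexx.
by move=> v /andP[v0 _]; exact: IH.
Qed.

Lemma pitman_word_reduced T w r q p : 0 <= T -> reduced_word S w r ->
  reduced_word S w q -> is_path T p -> path_eq T (pw r p) (pw q p).
Proof.
move=> T0 hr hq; move: p.
apply: (matsumoto hWS (E := fun r q => forall p, is_path T p ->
  path_eq T (pw r p) (pw q p))) hr hq => {r q w}.
- by move=> r p _ t.
- by move=> r q h p hp; exact/path_eq_sym/h.
- by move=> r q z h1 h2 p hp; exact: path_eq_trans (h1 p hp) (h2 p hp).
- by move=> s r q sS h p hp; exact/pitman_eq/h.
move=> s t z sS tS st zS p hp; rewrite !pitman_word_cat.
by apply: (pitman_braid T0 hWS hroots) => //; exact: (pitman_word_path hroots).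
Qed.

Lemma fold_vec_word_reduced w r q x : reduced_word S w r -> reduced_word S w q
  ->
  fold_vec_word r x = fold_vec_word q x.
Proof.
move=> hr hq.
have := pitman_word_reduced ler01 hr hq (line_path 1 x).
by move=> /(_ 1); rewrite ler01 lexx !pitman_word_line// /line !scale1r; apply.
Qed.

Lemma fold_vec_ge0 s x : s \in S -> 0 <= coalpha s (fold_vec s x).
Proof.
move=> sS; rewrite /fold_vec linearB /= scalarZ (coroot_root hroots)//.
by have [|] := leP 0 (coalpha s x); lra.
Qed.

Lemma fold_vec_id s x : 0 <= coalpha s x -> fold_vec s x = x.
Proof. by move=> h; rewrite /fold_vec min_l// scale0r subr0. Qed.

Lemma fold_vec_dominant r x : words S r -> vdominant x -> fold_vec_word r x = x.
Proof.
elim: r => //= s r IH /words_cons[sS rS] hx.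
by rewrite IH// fold_vec_id// hx.
Qed.

Lemma fold_vec_refl s x : s \in S -> fold_vec s (rho s x) = fold_vec s x.
Proof.
move=> sS; rewrite /fold_vec rho_refl// linearB /= scalarZ (coroot_root
  hroots)//.
rewrite -addrA -opprD -scalerDl; congr (_ - _ *: _).
have -> : coalpha s x - coalpha s x * 2 = - coalpha s x by ring.
by have [|] := leP 0 (coalpha s x); have [|] := leP 0 (- coalpha s x); lra.
Qed.

(** [q] keeps the letters at which the fold is a genuine reflection. *)
Lemma fold_vec_subword r x : words S r ->
  exists q, [/\ words S q, subseq q r & fold_vec_word r x = rho (prodw q) x].
Proof.
elim: r => [|s r IH]; first by exists [::]; rewrite big_nil rho1.
move=> /words_cons[sS /IH[q [qS qr e]]] /=; rewrite {}e.
have [h|h] := leP 0 (coalpha s (rho (prodw q) x)).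
  exists q; split=> //; first exact: subseq_trans qr (subseq_cons _ _).
  exact: fold_vec_id.
exists (s :: q); split; [exact/words_cons|by rewrite /= eqxx|].
by rewrite big_cons rhoM (rho_refl _ sS)// /fold_vec min_r// ltW.
Qed.

(** * The longest element in the reflection representation *)

Section Longest.
Variables (w0 : W) (r : seq W).
Hypothesis hw0 : longest_element S w0.
Hypothesis hr : reduced_word S w0 r.
Let rS : words S r := reduced_words hr.

Lemma fold_left_max w q x : reduced_word S w q ->
  {in S, forall s, exists q', reduced_word S w (s :: q')} ->
  vdominant (fold_vec_word q x).
Proof.
move=> hq hw s sS; have [q' hq'] := hw s sS.
by rewrite (fold_vec_word_reduced x hq hq'); exact: fold_vec_ge0.
Qed.

Lemma fold_longest_dominant x : vdominant (fold_vec_word r x).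
Proof. by apply: fold_left_max hr _ => s; exact: longest_left. Qed.

(** A reduced word of [w0] can be chosen to end with any [s], and its first fold then identifies [x]
    with [rho s x]. *)
Lemma fold_longest_orbit w x : fold_vec_word r (rho w x) = fold_vec_word r x.
Proof.
have [q [qS <-]] := words_exist hWS w.
elim: q qS => [|s q IH]; first by rewrite big_nil rho1.
move=> /words_cons[sS qS]; rewrite big_cons rhoM.
have [z hz] := longest_right hWS hw0 sS.
rewrite (fold_vec_word_reduced _ hr hz) /fold_vec_word foldr_rcons.
by rewrite fold_vec_refl// -foldr_rcons -/(fold_vec_word _ _)
  -(fold_vec_word_reduced _ hr hz) IH.
Qed.

Lemma dominant_orbit w x : vdominant x -> vdominant (rho w x) -> rho w x = x.
Proof.
move=> hx hwx; rewrite -(fold_vec_dominant rS hwx) fold_longest_orbit.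
exact: fold_vec_dominant.
Qed.

(** By faithfulness each [u != 1] has a proper fixed space, and finitely many of these do not cover
    [V]: a vector moved by the elements treated so far is shifted along a direction [y] moved by the
    next one. *)
Lemma free_vector : exists v, forall u, rho u v = v -> u = 1%g.
Proof.
suff [v hv] : exists v, forall u, u \in enum [set u : W | u != 1%g] -> rho u v
  <> v.
  exists v => u e; apply/eqP/negPn/negP => u1.
  by apply: hv e; rewrite mem_enum inE.
have : forall u, u \in enum [set u : W | u != 1%g] -> u != 1%g.
  by move=> u; rewrite mem_enum inE.
elim: (enum _) => [|u l IH] h; first by exists 0.
have [v hv] : exists v, forall u, u \in l -> rho u v <> v.
  by apply: IH => u' h'; apply: h; rewrite inE h' orbT.
have [y hy] : exists y, rho u y <> y.
  apply: contrapT => hn; have : u != 1%g by apply: h; rewrite inE eqxx.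
  apply/negP/negPn/eqP; apply: rho_inj => x; rewrite rho1; apply: contrapT =>
    hx.
  by apply: hn; exists x.
have [e|ne] := pselect (rho u v = v); last first.
  by exists v => u'; rewrite inE => /orP[/eqP->//|/hv].
(* Each element of [l] forbids at most one [c]: with two of them it would fix [y], hence also
   [v]. *)
have [B hB] : exists B : seq R, forall c, c \notin B ->
    forall u, u \in l -> rho u (v + c *: y) <> v + c *: y.
  elim: {IH h} l hv => [|u' l IH] hv; first by exists [::].
  have [B hB] : exists B : seq R, forall c, c \notin B ->
      forall u, u \in l -> rho u (v + c *: y) <> v + c *: y.
    by apply: IH => z zl; apply: hv; rewrite inE zl orbT.
  have [[c hc]|hn] := pselect (exists c, rho u' (v + c *: y) = v + c *: y).
    exists (c :: B) => d; rewrite inE negb_or => /andP[dc dB] z.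
    rewrite inE => /orP[/eqP->|zl]; last exact: hB.
    move=> hd; have ey : rho u' y = y.
      rewrite linearD linearZ /= in hc; rewrite linearD linearZ /= in hd.
      have /= := congr2 (fun a b => a - b) hd hc;
        rewrite !opprD !(addrACA _ (_ *: _)) !subrr !add0r.
      by rewrite -!scalerBl => /(scalerI _); apply; rewrite subr_eq0.
    move: hd; rewrite linearD linearZ /= ey => /addIr.
    by apply: hv; rewrite inE eqxx.
  exists B => d dB z; rewrite inE => /orP[/eqP-> hd|zl]; last exact: hB.
  by apply: hn; exists d.
have [c] := avoid_seq (0 :: B); rewrite inE negb_or => /andP[c0 cB].
exists (v + c *: y) => u'; rewrite inE => /orP[/eqP->|]; last exact: hB.
by rewrite linearD linearZ /= e => /addrI /(scalerI c0).
Qed.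

(** Folding a free vector stays in its orbit, so the result is free; a zero pairing would make [s]
    fix it. *)
Lemma regular_dominant : exists v, [/\ forall u, rho u v = v -> u = 1%g &
  {in S, forall s, 0 < coalpha s v}].
Proof.
have [v hv] := free_vector; exists (fold_vec_word r v).
have [q [_ _ e]] := fold_vec_subword v rS.
have free u : rho u (fold_vec_word r v) = fold_vec_word r v -> u = 1%g.
  rewrite e -rhoM => eu.
  have /hv/eqP : rho ((prodw q)^-1 * (u * prodw q)) v = v by rewrite rhoM eu
    rhoK.
  by rewrite -conjgE conjg_eq1 => /eqP.
split=> // s sS; rewrite lt_neqAle fold_longest_dominant// andbT eq_sym.
apply/negP => /eqP h; have := free s; rewrite rho_refl// h scale0r subr0 =>
  /(_ erefl) s1.
by case: hWS => /(_ s sS); rewrite s1 order1.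
Qed.

(** For [v] regular dominant, folding [rho w0^-1 v] along [q] gives a dominant point of the orbit,
    that is [v]. Hence a subword of [q] is a word of [w0], and by length it is all of [q]. *)
Lemma left_max_longest w q : reduced_word S w q ->
  {in S, forall s, exists q', reduced_word S w (s :: q')} -> w = w0.
Proof.
move=> hq hw; have [v [free pos]] := regular_dominant.
have vdom : vdominant v by move=> s /pos/ltW.
have := fold_left_max (rho w0^-1%g v) hq hw.
have [q' [q'S sub e]] := fold_vec_subword (rho w0^-1%g v) (reduced_words hq).
rewrite e -rhoM => /(dominant_orbit vdom) /free /eqP.
rewrite -eq_mulgV1 => /eqP eq'.
have le1 : (size r <= size q')%N by apply: (reduced_le hr).
have le2 : (size q <= size r)%N by apply: hw0 hq hr.
have /eqP eqq : q' == q.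
  by rewrite -(size_subseq_leqif sub) eqn_leq size_subseq// (leq_trans le2).
by rewrite -(reduced_prod hq) -eqq.
Qed.

Lemma longest_unique w : longest_element S w -> w = w0.
Proof.
move=> hw; have [q hq] := reduced_exists hWS w.
by apply: left_max_longest hq _ => s; exact: longest_left.
Qed.

Lemma longest_invK : w0^-1%g = w0.
Proof. exact/longest_unique/(longest_inv hWS). Qed.

Lemma rho_longestK x : rho w0 (rho w0 x) = x.
Proof. by rewrite -{1}longest_invK rhoK. Qed.

(** Otherwise the first fold along a word of [w0] ending in [s] would do nothing, and a subword of
    the remaining letters, too short, would be a word of [w0]. *)
Lemma longest_coroot_lt0 v s : (forall u, rho u v = v -> u = 1%g) ->
  vdominant v -> s \in S -> coalpha s (rho w0 v) < 0.
Proof.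
move=> free vdom sS; rewrite ltNge; apply/negP => h.
have [q hq] := longest_right hWS hw0 sS.
have := fold_longest_orbit w0 v.
rewrite (fold_vec_dominant rS vdom) (fold_vec_word_reduced _ hr hq).
rewrite /fold_vec_word foldr_rcons fold_vec_id// -/(fold_vec_word _ _).
have qS : words S q by move=> x xq; apply: (reduced_words hq);
  rewrite mem_rcons inE xq orbT.
have [q' [q'S sub ->]] := fold_vec_subword (rho w0 v) qS.
rewrite -rhoM => /free e; have e0 : prodw q' = w0.
  by apply: (mulIg w0); rewrite e -{1}longest_invK mulVg.
have : (size (rcons q s) <= size q')%N by apply: (reduced_le hq).
by rewrite size_rcons leqNgt ltnS (size_subseq sub).
Qed.

(** As [w0 * s] differs from [w0], some [t] is not a left descent of it; then [t * (w0 * s)] has the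
    length of [w0] and equals it by uniqueness. *)
Lemma longest_conj s : s \in S -> exists2 t, t \in S & (t * w0 = w0 * s)%g.
Proof.
move=> sS; have [q hq] := longest_right hWS hw0 sS.
have hz : reduced_word S (w0 * s)%g q.
  have := reduced_rev hWS hq; rewrite rev_rcons =>
    /(reduced_cons hWS)[_] /(reduced_rev hWS).
  by rewrite revK invMg invgK (invs hWS sS).
have zw : (w0 * s)%g <> w0.
  move=> e; have s1 : s = 1%g by apply: (mulgI w0); rewrite mulg1.
  by case: hWS => /(_ s sS); rewrite s1 order1.
have [t tS ht] : exists2 t, t \in S & ~ exists q', reduced_word S (w0 * s)%g (t
  :: q').
  apply: contrapT => hn; apply: zw; apply: left_max_longest hz _ => t tS.
  by apply: contrapT => ht; apply: hn; exists t.
exists t => //; have [hq'|//] := left_descent hWS tS hz.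
have e : (t * (w0 * s) = w0)%g.
  apply: longest_unique => w z z0 hz1 hz0; rewrite (reduced_size hz0 hq') /=.
  by rewrite -(size_rcons q s); apply: hw0 hz1 hq.
by apply: (mulIg s); rewrite -mulgA e -mulgA (mulss hWS sS) mulg1.
Qed.

(** The reflections [t] and [w0 s w0] agree, so their rank-one parts do, which fixes root and coroot
    up to a scalar. Its sign is read at a regular dominant vector. *)
Lemma longest_root s : s \in S -> exists t (c : R), [/\ t \in S, 0 < c,
  rho w0 (alpha s) = - (c *: alpha t) &
  forall x, coalpha t (rho w0 x) = - (c * coalpha s x)].
Proof.
move=> sS; have [t tS ets] := longest_conj sS.
have [v [free pos]] := regular_dominant.
have vdom : vdominant v by move=> z /pos/ltW.
have key x : coalpha t x *: alpha t = coalpha s (rho w0 x) *: rho w0 (alpha s).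
  have : rho t x = rho w0 (rho s (rho w0 x)).
    by rewrite -!rhoM ?mulgA -ets -mulgA -{2}longest_invK mulgV mulg1.
  by rewrite (rho_refl _ tS) (rho_refl _ sS) rhoBZ rho_longestK =>
    /addrI/oppr_inj.
have lt0 := longest_coroot_lt0 free vdom sS; have gt0 := pos t tS.
pose c := - (coalpha t v / coalpha s (rho w0 v)).
have c0 : 0 < c by rewrite oppr_gt0 pmulr_rlt0// invr_lt0.
have e1 : rho w0 (alpha s) = - (c *: alpha t).
  rewrite /c scaleNr opprK mulrC -scalerA key scalerA mulVf ?scale1r//.
  by rewrite lt_eqF.
exists t, c; split=> // x.
have := congr1 (coalpha t) (key (rho w0 x)).
rewrite rho_longestK e1 scalerN scalerA -scaleNr !scalarZ (coroot_root
  hroots)// => h.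
by move: h; lra.
Qed.

End Longest.
End Vectors.

(** * The involution *)

Section EnergyForm.
Variables (R : realType) (V : topologicalLmodType R).
Variables (W : finGroupType) (S : {set W}) (rho : W -> {linear V -> V}).
Variables (alpha : W -> V) (coalpha : W -> {scalar V}).
Hypothesis hWS : coxeter_system S.
Hypothesis hW : linear_group rho.
Hypothesis hroots : simple_roots S rho alpha coalpha.
Implicit Types (x y : V) (s t w u : W) (c : R).

(** Summing over the group gives an invariant positive semidefinite form without any scalar product
    on [V]; it is positive on the simple roots. *)
Definition inv_form x y : R :=
  \sum_(u : W) \sum_(s in S) coalpha s (rho u x) * coalpha s (rho u y).

Lemma inv_formC x y : inv_form x y = inv_form y x.
Proof. by apply: eq_bigr => u _; apply: eq_bigr => s _; rewrite mulrC. Qed.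

Lemma inv_formBZ x c y z : inv_form (x - c *: y) z = inv_form x z - c *
  inv_form y z.
Proof.
rewrite /inv_form mulr_sumr -sumrB; apply: eq_bigr => u _.
rewrite mulr_sumr -sumrB; apply: eq_bigr => s _.
by rewrite rhoBZ linearB /= scalarZ mulrBl mulrA.
Qed.

Lemma inv_form_rho w x y : inv_form (rho w x) (rho w y) = inv_form x y.
Proof.
rewrite [RHS](reindex_inj (mulIg w)); apply: eq_bigr => u _.
by apply: eq_bigr => s _; rewrite !(rhoM hW).
Qed.

Lemma inv_form_root_gt0 s : s \in S -> 0 < inv_form (alpha s) (alpha s).
Proof.
move=> sS; have ge0 u : 0 <= \sum_(t in S) coalpha t (rho u (alpha s)) *
  coalpha t (rho u (alpha s)).
  by apply: sumr_ge0 => t _; rewrite -expr2 sqr_ge0.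
rewrite /inv_form (bigD1 1%g)//= ltr_pwDl ?sumr_ge0//.
rewrite (bigD1 s)//= ltr_pwDl ?sumr_ge0//; last by move=> t _;
  rewrite -expr2 sqr_ge0.
by rewrite (rho1 hW) (coroot_root hroots)//; lra.
Qed.

(** [rho s] preserves the form and sends [alpha s] to its opposite. *)
Lemma inv_form_root s x : s \in S ->
  2 * inv_form x (alpha s) = coalpha s x * inv_form (alpha s) (alpha s).
Proof.
move=> sS; have := inv_form_rho s x (alpha s).
rewrite !(rho_refl hroots _ sS) (coroot_root hroots)// inv_formBZ.
rewrite !(inv_formC _ (alpha s - _)) !inv_formBZ (inv_formC (alpha s) x).
lra.
Qed.

Lemma inv_form_move s x c : s \in S ->
  inv_form (x - c *: alpha s) (x - c *: alpha s) =
  inv_form x x - c * (coalpha s x - c) * inv_form (alpha s) (alpha s).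
Proof.
move=> sS; have := inv_form_root x sS.
by rewrite inv_formBZ !(inv_formC _ (_ - _)) !inv_formBZ (inv_formC (alpha s)
  x); nra.
Qed.

(* The end point moves from x to x + c alpha with 0 <= c and
   0 <= c + alpha^v(x), so x lies on the segment joining the new end point to
   its reflection. *)
Lemma pitman_energy T s p : 0 <= T -> s \in S -> is_path T p ->
  let q := pitman (alpha s) (coalpha s) p in
  inv_form (p T) (p T) <= inv_form (q T) (q T) /\
  (inv_form (q T) (q T) <= inv_form (p T) (p T) -> q T = p T \/ q T = rho s (p
    T)).
Proof.
move=> T0 sS hp q; pose I := winf (fun a : R => coalpha s (p a)) 0 T.
have lb : lbdd (fun a : R => coalpha s (p a)) 0 T.
  by apply: edcont_lbdd => //; apply: is_path_edcont => //;
    exact: (coroot_continuous hroots).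
have I0 : I <= 0.
  have : I <= coalpha s (p 0) by apply: winf_le; rewrite // lexx.
  by case: hp => _ ->; rewrite linear0.
have IT : I <= coalpha s (p T) by apply: winf_le; rewrite // lexx T0.
have n0 := inv_form_root_gt0 sS.
rewrite {}/q pitmanE -/I inv_form_move//.
set k := coalpha s (p T) in IT *; set n := inv_form (alpha s) (alpha s) in n0 *.
have ge0 : 0 <= - I * (k - I) by rewrite mulr_ge0//; lra.
split; first by have := mulr_ge0 ge0 (ltW n0); lra.
move=> le; have : - I * (k - I) = 0.
  apply/eqP; rewrite eq_le ge0 andbT -(pmulr_lle0 _ n0); lra.
move=> /eqP; rewrite mulf_eq0 oppr_eq0 subr_eq0 => /orP[/eqP->|/eqP <-].
  by left; rewrite scale0r subr0.
by right; rewrite (rho_refl hroots).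
Qed.

(** No step decreases the form, so equality for the whole word forces equality at each step. *)
Lemma pitman_word_energy T r p : 0 <= T -> words S r -> is_path T p ->
  let q := pitman_word alpha coalpha r p in
  inv_form (p T) (p T) <= inv_form (q T) (q T) /\
  (inv_form (q T) (q T) <= inv_form (p T) (p T) -> exists w, q T = rho w (p T)).
Proof.
move=> T0 rS hp /=; elim: r rS => [|s r IH].
  by split=> // _; exists 1%g; rewrite (rho1 hW).
move=> /words_cons[sS rS] /=; have [IH1 IH2] := IH rS.
have hq : is_path T (pitman_word alpha coalpha r p) by exact: (pitman_word_path
  hroots).
have [h1 h2] := pitman_energy T0 sS hq.
split; first exact: le_trans h1.
move=> le; have [w e] := IH2 (le_trans h1 le).
have [->|->] := h2 (le_trans le IH1); first by exists w.
by exists (s * w)%g; rewrite (rhoM hW) e.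
Qed.

End EnergyForm.

(** * The properties of [I] *)

Section Involution.
Variables (R : realType) (V : topologicalLmodType R).
Variables (W : finGroupType) (S : {set W}) (rho : W -> {linear V -> V}).
Variables (alpha : W -> V) (coalpha : W -> {scalar V}).
Variables (w0 : W) (r : seq W) (T : R).
Hypothesis hWS : coxeter_system S.
Hypothesis hW : linear_group rho.
Hypothesis hroots : simple_roots S rho alpha coalpha.
Hypothesis hw0 : longest_element S w0.
Hypothesis hr : reduced_word S w0 r.
Hypothesis T0 : 0 <= T.
Let rS : words S r := reduced_words hr.
Implicit Types (p q : R -> V) (s w : W).

Local Notation pw := (pitman_word alpha coalpha).
Local Notation P s := (pitman (alpha s) (coalpha s)).
Local Notation neg := (neg_act rho w0).
Local Notation I := (involution_I T rho alpha coalpha w0 r).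

(** Continuity comes from writing [w] as a product of simple reflections, whose coroots are
    continuous. *)
Lemma rho_within w p : {within `[0, T], continuous p} ->
  {within `[0, T], continuous (fun u => rho w (p u))}.
Proof.
have [q [qS <-]] := words_exist hWS w; move=> cp.
elim: q qS => [|s q IH].
  by move=> _; rewrite big_nil (_ : (fun u => _) = p)//; apply/funext => u;
    rewrite (rho1 hW).
move=> /words_cons[sS qS]; rewrite big_cons; set x := (\prod_(_ <- _) _)%g in
  IH *.
rewrite (_ : (fun u => _) = fun u => rho x (p u) - coalpha s (rho x (p u)) *:
  alpha s).
  apply: within_sub; first exact: IH.
  apply: within_scale; apply: within_comp; last exact: IH.
  exact: (coroot_continuous hroots).
by apply/funext => u; rewrite (rhoM hW) (rho_refl hroots).
Qed.

Lemma neg_path p : is_path T p -> is_path T (neg p).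
Proof.
move=> [cp p0]; split; last by rewrite /neg_act p0 linear0 oppr0.
rewrite (_ : neg p = fun u => 0 - rho w0 (p u)); last by apply/funext => u;
  rewrite sub0r.
apply: within_sub; last exact: rho_within.
by apply: continuous_subspaceT => u; exact: cvg_cst.
Qed.

Lemma neg_eq p q : path_eq T p q -> path_eq T (neg p) (neg q).
Proof. by move=> e t tT; rewrite /neg_act e. Qed.

Lemma neg_kappa p : neg (kappa T p) = kappa T (neg p).
Proof. by apply/funext => t; rewrite /neg_act /kappa linearB opprB opprK addrC.
  Qed.

Lemma neg_kappaK p t : is_path T p -> neg (kappa T (neg (kappa T p))) t = p t.
Proof.
move=> [_ p0]; rewrite -neg_kappa /neg_act linearN opprK.
by rewrite (rho_longestK hWS hW hroots hw0 hr) kappaK.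
Qed.

Lemma involution_path p : is_path T p -> is_path T (I p).
Proof.
by move=> hp; apply: (pitman_word_path hroots) => //; apply/neg_path/kappa_path.
Qed.

(** The factor [c] of [longest_root] comes out of the infimum on one side and off the root on the
    other. *)
Lemma neg_pitman s : s \in S -> exists2 t, t \in S &
  forall p, is_path T p -> path_eq T (neg (P s p)) (P t (neg p)).
Proof.
move=> sS; have [t [c [tS c0 e1 e2]]] := longest_root hWS hW hroots hw0 hr sS.
exists t => // p hp u /andP[u0 uT]; rewrite /neg_act !pitmanE rhoBZ e1.
rewrite (@eq_winf R (fun v => coalpha t (- rho w0 (p v))) (fun v =>
  c * coalpha s (p v))).
  rewrite winfZ ?(ltW c0)//.
    by rewrite scalerN opprK opprD scalerA mulrC.
  apply: (lbddW (edcont_lbdd T0 (is_path_edcont hp _))) => //.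
  exact: (coroot_continuous hroots).
by move=> v _; rewrite linearN e2 opprK.
Qed.

Lemma involution_pitman s p : s \in S -> is_path T p -> path_eq T (I (P s p))
  (I p).
Proof.
move=> sS hp; have [t tS ht] := neg_pitman sS.
have [q hq] := longest_right hWS hw0 tS.
(* [P_w0] is taken along a reduced word ending in [t], so that [P t] acts directly after [kappa]. *)
have step x : is_path T x -> path_eq T (I x) (pw q (P t (kappa T (neg x)))).
  move=> hx; rewrite -neg_kappa.
  have hnx : is_path T (neg (kappa T x)) by apply/neg_path/kappa_path.
  have := pitman_word_reduced hWS hroots T0 hr hq hnx.
  by rewrite -cats1 pitman_word_cat.
have ct := coroot_continuous hroots.
have hsp : is_path T (P s p) by apply: pitman_path => //; exact: ct.
apply: (path_eq_trans (step _ hsp)); apply: path_eq_sym.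
apply: (path_eq_trans (step _ hp)); apply/pitman_word_eq/path_eq_sym.
apply: (path_eq_trans (q := P t (kappa T (P t (neg p))))).
  exact/pitman_eq/kappa_eq/ht.
by apply: pitman_kappa; [exact: ct|exact: (coroot_root hroots)|exact: neg_path].
Qed.

Lemma involution_pitman_word z p : words S z -> is_path T p -> path_eq T (I (pw
  z p)) (I p).
Proof.
elim: z => [|s z IH]; first by move=> _ _ t.
move=> /words_cons[sS zS] hp; apply: path_eq_trans (IH zS hp).
by apply: involution_pitman => //; exact: (pitman_word_path hroots).
Qed.

Lemma involution_sqr p : is_path T p -> path_eq T (I (I p)) (pw r p).
Proof.
move=> hp; have hn : is_path T (neg (kappa T p)) by apply/neg_path/kappa_path.
apply: (path_eq_trans (involution_pitman_word rS hn)).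
by apply: pitman_word_eq => t _; exact: neg_kappaK.
Qed.

(** The running infimum is at most [coalpha s (p u)] and at most the initial value [0], so
    subtracting it twice leaves a nonnegative number. *)
Lemma pitman_dominant s p : s \in S -> is_path T p ->
  forall u, 0 <= u <= T -> 0 <= coalpha s (P s p u).
Proof.
move=> sS hp u /andP[u0 uT]; rewrite coroot_pitman (coroot_root hroots)//.
have ct := coroot_continuous hroots sS.
have lb : lbdd (fun v => coalpha s (p v)) 0 u.
  by apply: (lbddW (edcont_lbdd T0 (is_path_edcont hp ct))).
have h1 : winf (fun v => coalpha s (p v)) 0 u <= coalpha s (p u).
  by apply: winf_le; rewrite // u0 lexx.
have : winf (fun v => coalpha s (p v)) 0 u <= coalpha s (p 0).
  by apply: winf_le; rewrite // u0 lexx.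
by case: hp => _ ->; rewrite linear0; lra.
Qed.

Lemma longest_dominant p : is_path T p -> dominant T S coalpha (pw r p).
Proof.
move=> hp; split; first exact: (pitman_word_path hroots).
move=> s sS u uT; have [q hq] := longest_left hWS hw0 sS.
rewrite (pitman_word_reduced hWS hroots T0 hr hq hp)//.
apply: pitman_dominant => //; apply: (pitman_word_path hroots) => //.
by have /(reduced_cons hWS)[_ /reduced_words] := hq.
Qed.

Lemma pitman_word_dominant z p : words S z -> dominant T S coalpha p ->
  path_eq T (pw z p) p.
Proof.
move=> zS [hp dp]; elim: z zS => [|s z IH]; first by move=> _ t.
move=> /words_cons[sS /IH e]; apply: (path_eq_trans (pitman_eq _ _ e)).
move=> u /andP[u0 uT]; rewrite pitmanE (winf_eq (c := 0)) ?scale0r ?subr0//.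
  by move=> v /andP[v0 vu]; apply: dp => //; rewrite v0 (le_trans vu).
move=> e' e0; exists 0; first by rewrite lexx.
by case: hp => _ ->; rewrite linear0 add0r.
Qed.

Lemma dominant_vdominant p : dominant T S coalpha p -> vdominant S coalpha (p
  T).
Proof. by move=> [_ h] s sS; apply: h; rewrite // T0 lexx. Qed.

Lemma involution_dominant p : is_path T p -> dominant T S coalpha (I p).
Proof. by move=> hp; apply: longest_dominant; apply/neg_path/kappa_path. Qed.

Lemma involution_end_dominant p : dominant T S coalpha p -> I p T = p T.
Proof.
move=> hp; have TT : 0 <= T <= T by rewrite T0 lexx.
have end_neg q : is_path T q -> neg (kappa T q) T = rho w0 (q T).
  by move=> [_ q0]; rewrite /neg_act /kappa subrr q0 sub0r linearN opprK.
have hn q : is_path T q -> is_path T (neg (kappa T q)).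
  by move=> hq; apply/neg_path/kappa_path.
have pp : is_path T p by case: hp.
have pI := involution_path pp.
(* The form at the end point does not decrease from [p] to [I p], nor from [I p] to [I (I p)], which
   ends at [p T] again. Equality therefore holds, and [eq1] puts [I p T] in the orbit of [p T]. *)
have [le1 eq1] := pitman_word_energy hW hroots T0 rS (hn _ pp).
have [le2 _] := pitman_word_energy hW hroots T0 rS (hn _ pI).
rewrite !end_neg// !(inv_form_rho S coalpha hW) in le1 le2 eq1.
have e : I (I p) T = p T.
  by rewrite involution_sqr// pitman_word_dominant.
have [w ew] := eq1 (le_trans le2 (eq_ind_r (fun x => _ x x <= _) (lexx _) e)).
rewrite -rhoM// in ew.
have d1 := dominant_vdominant (involution_dominant pp).
rewrite -/(I p) in ew; rewrite ew.
apply: (dominant_orbit hWS hW hroots hw0 hr); first exact: dominant_vdominant.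
by rewrite -ew.
Qed.

Lemma involution_end p : is_path T p -> I p T = pw r p T.
Proof.
move=> hp; have TT : 0 <= T <= T by rewrite T0 lexx.
rewrite -(involution_pitman_word rS hp)//.
exact/involution_end_dominant/longest_dominant.
Qed.

End Involution.

Theorem theorem4p7 (R : realType) (V : topologicalLmodType R)
    (W : finGroupType) (S : {set W}) (rho : W -> {linear V -> V})
    (alpha : W -> V) (coalpha : W -> {scalar V})
    (w0 : W) (r : seq W) (T : R)
    (hWS : coxeter_system S)
    (hW : linear_group rho)
    (hroots : simple_roots S rho alpha coalpha)
    (hw0 : longest_element S w0)
    (hr : reduced_word S w0 r)
    (hT : 0 < T) :
  let P := pitman_word alpha coalpha r in
  let I := involution_I T rho alpha coalpha w0 r in
  (forall p, is_path T p -> is_path T (I p)) /\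
  [/\ (forall p, is_path T p -> path_eq T (I (I p)) (P p)),
      (forall p, dominant T S coalpha p ->
        dominant T S coalpha (I p) /\ path_eq T (I (I p)) p),
      (forall p, is_path T p -> path_eq T (I (P p)) (I p)) &
      (forall p, is_path T p -> I p T = P p T) /\
      (forall p, dominant T S coalpha p -> I p T = p T)].
Proof.
move=> P I; have T0 := ltW hT; have rS := reduced_words hr.
split; first by move=> p; exact: (involution_path hWS hW hroots hr T0).
split=> [p hp|p hp|p hp|].
- exact: (involution_sqr hWS hW hroots hw0 hr T0).
- have pp : is_path T p by case: hp.
  split; first exact: (involution_dominant hWS hW hroots hw0 hr T0).
  apply: (path_eq_trans (involution_sqr hWS hW hroots hw0 hr T0 pp)).
  exact: (pitman_word_dominant alpha rS hp).
- exact: (involution_pitman_word hWS hW hroots hw0 hr T0 rS).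
- split=> p hp; first exact: (involution_end hWS hW hroots hw0 hr T0).
  exact: (involution_end_dominant hWS hW hroots hw0 hr T0).
Qed.
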